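(* For every $1\le p\le2$, every $p\le q\le\infty$ and every frequency $\lambda$, if $\sigma>L(\lambda)\big(\tfrac1p-\tfrac1q\big)$, then $\tau_\sigma$ maps $\mathcal{H}_p(\lambda)$ into $\mathcal{H}_q(\lambda)$.
   Context: A frequency is a strictly increasing sequence $\lambda=(\lambda_n)_{n\ge1}$ of non-negative real numbers tending to $\infty$. A $\lambda$-Dirichlet series is a formal series $D=\sum a_ne^{-\lambda_ns}$ with complex coefficients; it is a $\lambda$-Dirichlet polynomial if only finitely many $a_n$ are non-zero. For $1\le p<\infty$, $\mathcal{H}_p(\lambda)$ is the completion of the space of $\lambda$-Dirichlet polynomials under $$\|D\|_p=\lim_{T\to\infty}\Big(\frac1{2T}\int_{-T}^T\Big|\sum_n a_ne^{-\lambda_nit}\Big|^pdt\Big)^{1/p}.$$ Equivalently, and also for $p=\infty$: let $(G,\beta)$ be a $\lambda$-Dirichlet group, i.e. $G$ is a compact abelian group (with normalized Haar measure) and $\beta:(\mathbb{R},+)\to G$ is a continuous homomorphism with dense range such that for every $n$ there is a character $h_{\lambda_n}\in\widehat G$ with $h_{\lambda_n}(\beta(t))=e^{-i\lambda_nt}$ for all $t$; such a pair always exists. Then for $1\le p\le\infty$, $\mathcal{H}_p(\lambda)$ consists of all $\lambda$-Dirichlet series $\sum\widehat f(h_{\lambda_n})e^{-\lambda_ns}$ with $f\in L_p(G)$ and $\operatorname{supp}\widehat f\subseteq\{h_{\lambda_n}:n\ge1\}$, with norm $\|f\|_p$; this does not depend on the chosen group. For $\sigma\in\mathbb{R}$,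 $\tau_\sigma(\sum a_ne^{-\lambda_ns})=\sum a_ne^{-\lambda_n\sigma}e^{-\lambda_ns}$. ''$\tau_\sigma$ maps $\mathcal{H}_p(\lambda)$ into $\mathcal{H}_q(\lambda)$'' means $\tau_\sigma D\in\mathcal{H}_q(\lambda)$ for all $D\in\mathcal{H}_p(\lambda)$. $L(\lambda)=\limsup_{n\to\infty}\frac{\log n}{\lambda_n}\in[0,\infty]$, and $1/\infty=0$. *)

(* Defs.v *)
From HB Require Import structures.
From mathcomp Require Import all_boot all_order all_algebra.
From mathcomp Require Import complex.
From mathcomp Require Import all_classical all_reals all_analysis.

Set Implicit Arguments.
Unset Strict Implicit.
Unset Printing Implicit Defensive.

Import Order.TTheory GRing.Theory Num.Theory.
Import numFieldNormedType.Exports.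

Local Open Scope classical_set_scope.
Local Open Scope ring_scope.
Local Open Scope complex_scope.

(* Frequencies and Dirichlet series are indexed from 0: [lam n] and [a n]
   stand for lambda_(n+1) and a_(n+1). *)
Definition is_frequency (R : realType) (lam : nat -> R) : Prop :=
  [/\ forall n, 0 <= lam n,
      {homo lam : m n / (m < n)%N >-> m < n}
    & lam n @[n --> \oo] --> +oo].

(* The term n = 0 is log 1 / lambda_1, which is 0 even when lambda_1 = 0. *)
Definition abscissa (R : realType) (lam : nat -> R) : \bar R :=
  limn_esup (fun n => (ln n.+1%:R / lam n)%:E).

(* A formal series sum a_n e^(-lambda_n s) is its sequence of coefficients. *)
Definition dirichlet_series (R : realType) : Type := nat -> R[i].

Definition translate (R : realType) (lam : nat -> R) (sigma : R)
    (a : dirichlet_series R) : dirichlet_series R :=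
  fun n => a n * (expR (- (lam n * sigma)))%:C.

(* The library asks measurable types to be pointed, which topologicalZmodType
   does not provide; hence this copy of G, pointed at 0. *)
Definition pointed_group (G : topologicalZmodType) : Type := G.
HB.instance Definition _ (G : topologicalZmodType) :=
  Choice.on (pointed_group G).
HB.instance Definition _ (G : topologicalZmodType) :=
  isPointed.Build (pointed_group G) (0 : G).

Notation borel G :=
  (g_sigma_algebraType (@open G : set (set (pointed_group G)))).

(* Normalized Haar measure on a compact abelian group, written additively.
   Regularity is part of the definition since G need not be metrizable; for a
   finite measure inner regularity on all Borel sets gives outer regularity. *)
Definition is_haar (R : realType) (G : topologicalZmodType)
    (m : probability (borel G) R) : Prop :=
  (forall (x : G) (A : set (borel G)), measurable A ->
     m ((fun y : G => x + y) @^-1` A) = m A) /\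
  (forall A : set (borel G), measurable A ->
     m A = ereal_sup [set m K | K in [set K : set G | compact K /\ K `<=` A]]).

Definition is_character (R : realType) (G : topologicalZmodType)
    (h : G -> R[i]) : Prop :=
  [/\ continuous (h : G -> R[i]^o),
      forall x, `|h x| = 1
    & forall x y, h (x + y) = h x * h y].

(* [h] is the character h_x, i.e. h (beta t) = e^(-i x t). *)
Definition is_char_of_freq (R : realType) (G : topologicalZmodType)
    (beta : R -> G) (x : R) (h : G -> R[i]) : Prop :=
  is_character h /\
  forall t : R, h (beta t) = cos (x * t) -i* sin (x * t).

Record is_dirichlet_group (R : realType) (lam : nat -> R)
    (G : topologicalZmodType) (m : probability (borel G) R)
    (beta : R -> G) : Prop := {
  dg_compact : compact [set: G];
  dg_hausdorff : hausdorff_space G;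
  dg_haar : is_haar m;
  dg_continuous : continuous beta;
  dg_morph : {morph beta : s t / s + t};
  dg_dense : dense (range beta);
  dg_char : forall n, exists h : G -> R[i], is_char_of_freq beta (lam n) h
}.

Definition in_Lp (d : measure_display) (T : measurableType d) (R : realType)
    (m : {measure set T -> \bar R}) (p : \bar R) (f : T -> R[i]) : Prop :=
  [/\ measurable_fun [set: T] (fun x => complex.Re (f x)),
      measurable_fun [set: T] (fun x => complex.Im (f x))
    & (Lnorm m p (fun x => (complex.Re `|f x|)%:E) < +oo)%E].

Definition cintegral (d : measure_display) (T : measurableType d)
    (R : realType) (m : {measure set T -> \bar R}) (f : T -> R[i]) : R[i] :=
  Rintegral m [set: T] (fun x => complex.Re (f x)) +i*
  Rintegral m [set: T] (fun x => complex.Im (f x)).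

Definition fourier (R : realType) (G : topologicalZmodType)
    (m : probability (borel G) R) (f h : G -> R[i]) : R[i] :=
  cintegral m (fun x => f x * (h x)^*).

(* The space H_p(lambda), realized on the lambda-Dirichlet group (G, beta).
   Density of the range of beta makes the character h_(lambda_n) unique. *)
Definition Hp (R : realType) (lam : nat -> R) (G : topologicalZmodType)
    (m : probability (borel G) R) (beta : R -> G) (p : \bar R)
  : set (dirichlet_series R) :=
  [set a | exists f : G -> R[i],
    [/\ in_Lp m p (f : borel G -> R[i]),
        forall n h, is_char_of_freq beta (lam n) h -> a n = fourier m f h
      & forall h, is_character h -> fourier m f h != 0 ->
          exists n, is_char_of_freq beta (lam n) h]].

(* Main.v *)
Require Import Defs.
From HB Require Import structures.
From mathcomp Require Import all_boot all_order all_algebra.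
From mathcomp Require Import complex.
From mathcomp Require Import all_classical all_reals all_analysis.
From mathcomp Require Import measurable_realfun ess_sup_inf.
From mathcomp Require Import ring lra zify.

Set Implicit Arguments.
Unset Strict Implicit.
Unset Printing Implicit Defensive.

Import Order.TTheory GRing.Theory Num.Theory.
Import numFieldNormedType.Exports.

Local Open Scope classical_set_scope.
Local Open Scope ring_scope.
Local Open Scope complex_scope.
Import Normc.

(* Write tau_sigma f as the sum over k of the finite sums
     Q_k = sum_n e^(-sigma lam_n) tri(lam_n - k) a_n h_n,  tri x = max(0, 1 - |x|),
   which is possible because the translates tri(x - k), k >= 0, add up to 1 on
   [0, oo).  The function tri is a limit of Fourier transforms of discrete
   probability measures on the line (Fejer kernels), and such functions are
   closed under products, translations and exponentials, so that
   e^(-sigma x) tri(x - k) is, up to e^(2 sigma), a limit of transforms of measures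
   of mass e^(-sigma k).  Translating along beta, this gives
   |Q_k|_p <= e^(2 sigma) e^(-sigma k) |f|_p.  As Q_k has
   N_k = O(e^(L' k)) terms for every L' > L(lam), Nikolskii's inequality
   |Q|_oo <= N^(1/p) |Q|_p (here p <= 2 is used) yields
   |Q_k|_q <= N_k^(1/p - 1/q) |Q_k|_p, and the sum of the Q_k converges in L_q. *)

(** * The triangle function as a limit of discrete Fejer kernels *)

(** The blocks use overlapping hats because a sharp cutoff to [k <= x < k + 1] is discontinuous,
    hence not the transform of a finite measure. The factor e^(-sigma x) alone is unbounded on the
    line, so it becomes a multiplier only after localization by a hat. Nothing identifies Q_k with a
    convolution of f, which is known only through its Fourier coefficients. So Q_k is estimated by
    duality against trigonometric polynomials, where finitely many frequencies matter at a time.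
    This is why finite sums of point masses and approximation at finitely many points are enough,
    and no limit measure is ever formed. With theta = 1/p - 1/q and L' theta < sigma, the Nikolskii
    factor N_k^theta grows at most like e^(L' theta k), so the L_q norm of Q_k decays geometrically.
    A given lambda_n meets finitely many hats, so each Fourier coefficient of the partial sums is
    eventually constant; dominated convergence then yields the exact coefficients of the limit. *)

Lemma sum_cos_arith (R : realType) (a u : R) (n : nat) :
  (\sum_(j < n) cos ((j%:R - a) * u)) * (2 * sin (u / 2)) =
  sin ((n%:R - a - 2^-1) * u) + sin ((a + 2^-1) * u).
Proof.
elim: n => [|n IHn].
  rewrite big_ord0 mul0r.
  have -> : (0%:R - a - 2^-1) * u = - ((a + 2^-1) * u) by rewrite mulr0n; ring.
  by rewrite sinN addNr.
(* The sum telescopes because [2 sin(u/2) cos v = sin(v + u/2) - sin(v - u/2)]. *)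
rewrite big_ord_recr /= mulrDl IHn.
have -> : (n.+1%:R - a - 2^-1) * u = (n%:R - a) * u + u / 2.
  by rewrite -natr1; field.
have -> : (n%:R - a - 2^-1) * u = (n%:R - a) * u - u / 2 by field.
rewrite sinB sinD; ring.
Qed.

Lemma sin_natpi (R : realType) (n : nat) : sin (n%:R * pi) = 0 :> R.
Proof.
elim: n => [|n IHn]; first by rewrite mul0r sin0.
by rewrite -natr1 mulrDl mul1r sinDpi IHn oppr0.
Qed.

(** Orthogonality of the characters of Z/L for L = 2H + 1. Sampling symmetrically about [H] makes
    the exponential sums real, so cosines suffice, and turns both boundary sines into
    [sin ((a - b) pi) = 0]. *)
Lemma sum_cos_orthogonal (R : realType) (H a b : nat) :
  (a < H.*2.+1)%N -> (b < H.*2.+1)%N ->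
  \sum_(j < H.*2.+1)
    cos ((j%:R - H%:R) * (2 * pi / H.*2.+1%:R) * (a%:R - b%:R)) =
  H.*2.+1%:R * (a == b)%:R :> R.
Proof.
wlog ba : a b / (b <= a)%N => [hw aL bL|].
  have [/hw|/ltnW ab] := leqP b a; first exact.
  rewrite eq_sym -(hw b a ab bL aL).
  by apply: eq_bigr => j _; rewrite -cosN -mulrN opprB.
move=> aL bL.
have [->|ab] := eqVneq a b.
  rewrite mulr1 (eq_bigr (fun=> 1)) ?sumr_const ?card_ord //.
  by move=> j _; rewrite subrr mulr0 cos0.
rewrite mulr0.
set L : R := H.*2.+1%:R.
have L0 : L != 0 by rewrite pnatr_eq0.
have Lp : 0 < L by rewrite ltr0n.
set u := 2 * pi / L * (a%:R - b%:R).
have lab : (b < a)%N by rewrite ltn_neqAle eq_sym ab.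
(* Since 0 < a - b < L, the angle [u / 2] lies strictly between 0 and pi, so the factor
   [2 * sin (u / 2)] can be cancelled below. *)
have us : 0 < sin (u / 2).
  apply: sin_gt0_pi.
  have -> : u / 2 = (a - b)%:R / L * pi by rewrite /u natrB //; field.
  have pi0 := pi_gt0 R.
  rewrite mulr_gt0 //=; last by rewrite divr_gt0 // ltr0n subn_gt0.
  rewrite gtr_pMl // ltr_pdivrMr // mul1r /L ltr_nat.
  exact: leq_ltn_trans (leq_subr _ _) aL.
have := sum_cos_arith H%:R u H.*2.+1.
have -> : (H.*2.+1%:R - H%:R - 2^-1) * u = (a - b)%:R * pi.
  rewrite /u natrB // -/L.
  have -> : L = 2 * H%:R + 1 by rewrite /L -muln2 -natr1 natrM mulrC.
  by field; rewrite -natrM natr1 pnatr_eq0.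
have -> : (H%:R + 2^-1) * u = (a - b)%:R * pi.
  rewrite /u natrB //.
  have -> : L = 2 * H%:R + 1 by rewrite /L -muln2 -natr1 natrM mulrC.
  by field; rewrite -natrM natr1 pnatr_eq0.
rewrite sin_natpi addr0 => /eqP; rewrite mulf_eq0 => /orP[/eqP eq0|].
  rewrite -[RHS]eq0; apply: eq_bigr => j _.
  by rewrite -/L -mulrA.
by rewrite mulf_eq0 pnatr_eq0 /= gt_eqF.
Qed.

(* The weights are the values of the Fejer kernel at the L-th roots of unity. *)
Lemma discrete_fejer (R : realType) (H N : nat) : (0 < N)%N ->
  exists c : nat -> R, (forall j, 0 <= c j) /\
  forall k : nat, (N + k <= H.*2.+1)%N ->
  \sum_(j < H.*2.+1) c j * cos (k%:R * ((j%:R - H%:R) * (2 * pi / H.*2.+1%:R)))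
  = (N - k)%:R / N%:R.
Proof.
move=> N0.
set L : R := H.*2.+1%:R.
have L0 : L != 0 by rewrite pnatr_eq0.
have N0' : N%:R != 0 :> R by rewrite pnatr_eq0 -lt0n.
set t := fun j : nat => (j%:R - H%:R) * (2 * pi / L).
exists (fun j => ((\sum_(l < N) cos (l%:R * t j)) ^+ 2 +
                  (\sum_(l < N) sin (l%:R * t j)) ^+ 2) / (L * N%:R)).
split=> [j|k kN].
  by rewrite divr_ge0 ?addr_ge0 ?sqr_ge0 // mulr_ge0 ?ler0n.
have E (j : nat) : (\sum_(l < N) cos (l%:R * t j)) ^+ 2 +
         (\sum_(l < N) sin (l%:R * t j)) ^+ 2 =
    \sum_(l < N) \sum_(i < N) cos (t j * (l%:R - i%:R)).
  rewrite !expr2 !big_distrlr /= -big_split /=; apply: eq_bigr => l _.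
  rewrite -big_split /=; apply: eq_bigr => i _.
  by rewrite mulrBr cosB ![t j * _]mulrC.
under eq_bigr => j _ do rewrite -/L -/(t j) E mulrAC mulr_suml.
rewrite -mulr_suml.
rewrite (_ : \sum_(j < _) _ = L * (N - k)%:R); last first.
  under eq_bigr => j _ do under eq_bigr => l _ do rewrite mulr_suml.
  rewrite exchange_big /=.
  under eq_bigr => l _ do rewrite exchange_big /=.
  (* Product-to-sum leaves two orthogonality sums, which select the pairs with [i = l + k] and those
     with [l = i + k]. The bound [N + k <= 2H + 1] keeps [l + k] and [i + k] below L, so there is no
     aliasing. *)
  have F (l i : 'I_N) : \sum_(j < H.*2.+1)
      cos (t j * (l%:R - i%:R)) * cos (k%:R * t j) =
      L * (((l + k == i)%N)%:R + ((i + k == l)%N)%:R) / 2.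
    have -> : \sum_(j < H.*2.+1) cos (t j * (l%:R - i%:R)) * cos (k%:R * t j) =
       \sum_(j < H.*2.+1) (cos (t j * ((l + k)%:R - i%:R)) +
                           cos (t j * (l%:R - (i + k)%:R))) / 2.
      apply: eq_bigr => j _.
      have -> : t j * ((l + k)%:R - i%:R) = t j * (l%:R - i%:R) + k%:R * t j.
        by rewrite natrD; ring.
      have -> : t j * (l%:R - (i + k)%:R) = t j * (l%:R - i%:R) - k%:R * t j.
        by rewrite natrD; ring.
      by rewrite cosB cosD; field.
    have hl := ltn_ord l; have hi := ltn_ord i.
    rewrite -mulr_suml big_split /= !sum_cos_orthogonal ?[l == (i + k)%N :> nat]eq_sym;
      try lia.
    by rewrite -mulrDr.
  under eq_bigr => l _ do under eq_bigr => i _ do rewrite F.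
  have cnt : \sum_(l < N) \sum_(i < N) ((l + k == i)%N)%:R = (N - k)%:R :> R.
    have -> : \sum_(l < N) \sum_(i < N) ((l + k == i)%N)%:R =
              \sum_(0 <= l < N) ((l + k < N)%N)%:R :> R.
      rewrite big_mkord; apply: eq_bigr => l _.
      have [lk|lk] := ltnP (l + k) N.
        rewrite (bigD1 (Ordinal lk)) //= eqxx big1 ?addr0 // => i.
        by rewrite -val_eqE /= eq_sym => /negbTE ->.
      rewrite big1 // => i _; case: eqP => // h.
      by have := ltn_ord i; rewrite -h ltnNge lk.
    have [kN'|Nk] := leqP k N.
      rewrite (big_cat_nat (n := (N - k)%N)) ?leq_subr //=.
      rewrite [X in _ + X]big1_seq ?addr0; last first.
        by move=> l /=; rewrite mem_index_iota => h; case: ltnP => //; lia.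
      rewrite (eq_big_nat _ _ (F2 := fun=> 1)); last first.
        by move=> l h; case: ltnP => //; lia.
      by rewrite big_const_nat subn0 iter_addr_0.
    rewrite big1_seq => [|l /=]; last first.
      by rewrite mem_index_iota => h; case: ltnP => //; lia.
    by have -> : (N - k = 0)%N by lia.
  have -> : \sum_(l < N) \sum_(i < N)
      L * (((l + k == i)%N)%:R + ((i + k == l)%N)%:R) / 2 =
     L * (\sum_(l < N) \sum_(i < N) ((l + k == i)%N)%:R +
          \sum_(l < N) \sum_(i < N) ((i + k == l)%N)%:R) / 2.
    rewrite -big_split /= mulr_sumr mulr_suml; apply: eq_bigr => l _.
    by rewrite -big_split /= mulr_sumr mulr_suml; apply: eq_bigr => i _.
  by rewrite [X in _ + X]exchange_big /= cnt; field.
by field; rewrite N0' nat1r.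
Qed.

Lemma sqr_sin_half (R : realType) (x : R) : sin (x / 2) ^+ 2 = (1 - cos x) / 2.
Proof.
have -> : cos x = cos (x / 2 *+ 2) by congr cos; rewrite mulr2n; field.
rewrite cos_mulr2n mulr2n; have := cos2Dsin2 (x / 2).
set c := cos _; set s := sin _ => h.
by have -> : s ^+ 2 = 1 - c ^+ 2; [rewrite -h addrC addKr | field].
Qed.

Definition tri (R : realType) (x : R) : R := Num.max 0 (1 - `|x|).
Lemma cos_le_abs (R : realType) (x y : R) : `|x| <= `|y| -> `|y| <= pi ->
  cos y <= cos x.
Proof.
have cosabs (z : R) : cos `|z| = cos z by case: ger0P => // _; rewrite cosN.
move=> xy ypi; rewrite -(cosabs x) -(cosabs y) -subr_ge0.
set a := `|x|; set b := `|y|.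
have -> : cos a - cos b = 2 * sin ((a + b) / 2) * sin ((b - a) / 2).
  have -> : cos a = cos ((a + b) / 2 - (b - a) / 2) by congr cos; field.
  have -> : cos b = cos ((a + b) / 2 + (b - a) / 2) by congr cos; field.
  rewrite cosB cosD; ring.
have a0 : 0 <= a := normr_ge0 x.
have {}xy : a <= b := xy.
have {}ypi : b <= pi := ypi.
by rewrite !mulr_ge0 // sin_ge0_pi //; apply/andP; split; lra.
Qed.

(* Krein's inequality: the modulus of continuity of a positive definite function
   is controlled by its behaviour at 0. *)
Lemma sum_cos_modulus (R : realType) (n : nat) (c t : nat -> R) (d x y eta : R) :
  (forall j, 0 <= c j) -> \sum_(j < n) c j = 1 ->
  (forall j, (j < n)%N -> `|d * t j| <= pi) ->
  `|x - y| <= d -> 0 < eta ->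
  `|\sum_(j < n) c j * cos (x * t j) - \sum_(j < n) c j * cos (y * t j)| <=
  eta + (1 - \sum_(j < n) c j * cos (d * t j)) / (2 * eta).
Proof.
move=> c0 c1 tpi xy eta0.
have -> : eta + (1 - \sum_(j < n) c j * cos (d * t j)) / (2 * eta) =
    \sum_(j < n) c j * (eta + (1 - cos (d * t j)) / (2 * eta)).
  under [RHS]eq_bigr => j _ do rewrite mulrDr mulrA mulrBr mulr1.
  by rewrite big_split /= -!mulr_suml sumrB c1 mul1r.
rewrite -sumrB; apply: le_trans (ler_norm_sum _ _ _) _; apply: ler_sum => j _.
rewrite -mulrBr normrM ger0_norm // ler_wpM2l //.
set u := x * t j; set v := y * t j.
have -> : cos u - cos v = - (2 * sin ((u + v) / 2)) * sin ((u - v) / 2).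
  have -> : cos u = cos ((u + v) / 2 + (u - v) / 2) by congr cos; field.
  have -> : cos v = cos ((u + v) / 2 - (u - v) / 2) by congr cos; field.
  rewrite cosB cosD; ring.
have s1 : `|sin ((u + v) / 2)| <= 1 by exact: sin_max.
(* The cosine decreases in the absolute value of its argument only up to pi; this is where the bound
   on [d * t j] enters. *)
have s2 : sin ((u - v) / 2) ^+ 2 <= (1 - cos (d * t j)) / 2.
  rewrite sqr_sin_half; apply: ler_wpM2r => //; apply: lerB => //.
  apply: cos_le_abs; last exact: tpi.
  rewrite /u /v -mulrBl !normrM ler_wpM2r //.
  by apply: le_trans xy _; exact: ler_norm.
rewrite normrM normrN normrM (@ger0_norm _ 2) //.
set s := sin _ in s1 *; set r := sin ((u - v) / 2) in s2 *.
have : 2 * `|s| * `|r| <= 2 * `|r|.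
  by rewrite ler_wpM2r // -{2}[2]mulr1 ler_wpM2l.
move=> /le_trans; apply.
have -> : (1 - cos (d * t j)) / (2 * eta) = ((1 - cos (d * t j)) / 2) / eta.
  by field; rewrite gt_eqF.
(* The free parameter [eta] comes from [2 |r| <= eta + r^2 / eta]; it replaces the square root in
   the usual form of the inequality and keeps the bound linear in the weights. *)
apply: (@le_trans _ _ (eta + r ^+ 2 / eta)); last first.
  by rewrite lerD2l ler_pM2r ?invr_gt0.

rewrite -(ler_pM2r eta0) [leRHS]mulrDl divfK ?gt_eqF //. rewrite -real_normK ?num_real //.
have := sqr_ge0 (eta - `|r|); nra.
Qed.

Lemma tri_lip (R : realType) (x y : R) : `|tri x - tri y| <= `|x - y|.
Proof.
rewrite /tri; have h := lerB_normD x (y - x).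
have h1 : `|x| <= `|y| + `|x - y|.
  by rewrite -{1}(subrKC y x); exact: ler_normD.
have h2 : `|y| <= `|x| + `|x - y|.
  by rewrite distrC -{1}(subrKC x y); exact: ler_normD.
have h3 := normr_ge0 (x - y).
by rewrite ler_norml; apply/andP; split; case: (ltP 0 (1 - `|x|)) => ?;
  case: (ltP 0 (1 - `|y|)) => ?; lra.
Qed.

(** The Fejer weights reproduce [tri] exactly on the grid [k / N]. Off the grid both functions move
    little over a distance [1 / N]: [tri] is 1-Lipschitz, and Krein's inequality controls the cosine
    sum, whose value at [1 / N] is [1 - 1 / N]. *)
Lemma tri_cos_approx (R : realType) (M e : R) : 0 < e ->
  exists (n : nat) (c t : nat -> R), [/\ forall j, 0 <= c j,
    \sum_(j < n) c j = 1 &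
    forall x, `|x| <= M -> `|\sum_(j < n) c j * cos (x * t j) - tri x| <= e].
Proof.
move=> e0.
pose eta := e / 3.
have eta0 : 0 < eta by rewrite divr_gt0.
(* Exceeding both inverses gives [1 / N <= eta] and, for the term from Krein's inequality,
   [(1 / N) / (2 * eta) <= eta]. *)
pose N := (Num.truncn (eta^-1 + eta^-2)).+1.
have Ngt : eta^-1 + eta^-2 < N%:R by exact: truncnS_gt.
have Np : 0 < N%:R :> R by rewrite ltr0n.
have Nn : N%:R != 0 :> R by rewrite gt_eqF.
(* Large enough for [N + k <= 2H + 1] at every grid index [k <= |x| N] with [|x| <= M]. *)
pose H := (N + N * (Num.truncn `|M|).+1)%N.
have [c [c0 cE]] := discrete_fejer R H (ltn0Sn _ : (0 < N)%N).
pose L : R := H.*2.+1%:R.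
have Lp : 0 < L by rewrite ltr0n.
(* Scaling the nodes by [N] makes the value at [k / N] equal to the [k]-th discrete Fejer sum. *)
pose t j : R := N%:R * ((j%:R - H%:R) * (2 * pi / L)).
have c1 : \sum_(j < H.*2.+1) c j = 1.
  have := cE 0%N; rewrite subn0 divff // => <-; last by rewrite /H; lia.
  by apply: eq_bigr => j _; rewrite mul0r cos0 mulr1.
exists H.*2.+1, c, t; split => // x xM.
have tpi j : (j < H.*2.+1)%N -> `|N%:R^-1 * t j| <= pi.
  move=> jH; rewrite /t mulKf // normrM.
  have -> : `|2 * pi / L| = 2 * pi / L.
    by rewrite ger0_norm // divr_ge0 ?mulr_ge0 ?pi_ge0 // ltW.
  rewrite mulrA ler_pdivrMr // [leRHS]mulrC mulrA ler_wpM2r ?pi_ge0 //.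
  have jl : j%:R <= 2 * H%:R :> R by rewrite -natrM ler_nat; lia.
  have -> : L = 2 * H%:R + 1 by rewrite /L -muln2 -natr1 natrM mulrC.
  have j0 : 0 <= j%:R :> R by [].
  have : `|j%:R - H%:R| <= H%:R :> R.
    by rewrite ler_norml; apply/andP; split; lra.
  lra.
pose k := Num.truncn (`|x| * N%:R).
have /andP[k1 k2] : k%:R <= `|x| * N%:R < k.+1%:R.
  by apply: truncn_itv; rewrite mulr_ge0.
have xy : `| `|x| - k%:R / N%:R| <= N%:R^-1.
  have -> : `|x| - k%:R / N%:R = (`|x| * N%:R - k%:R) / N%:R by field.
  rewrite ger0_norm ?divr_ge0 ?subr_ge0 // ler_pdivrMr // mulVf // lerBlDr.
  by rewrite addrC natr1 ltW.
have kH : (N + k <= H.*2.+1)%N.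
  have : (k <= N * (Num.truncn `|M|).+1)%N.
    rewrite -(ler_nat R) natrM; apply: le_trans k1 _.
    rewrite mulrC ler_wpM2l //; apply: le_trans xM _.
    by apply: le_trans (ler_norm _) (ltW (truncnS_gt _)).
  by rewrite /H; lia.
have mk : \sum_(j < H.*2.+1) c j * cos (k%:R / N%:R * t j) = tri (k%:R / N%:R).
  have := cE k kH; rewrite /tri (@ger0_norm _ (k%:R / N%:R)) ?divr_ge0 //.
  have -> : Num.max 0 (1 - k%:R / N%:R) = (N - k)%:R / N%:R :> R.
    have -> : 1 - k%:R / N%:R = (N%:R - k%:R) / N%:R :> R by field.
    have [kN|Nk] := leqP k N.
      by rewrite natrB // max_r // divr_ge0 // subr_ge0 ler_nat.
    have -> : (N - k = 0)%N by lia.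
    by rewrite max_l ?mul0r // pmulr_lle0 ?invr_gt0 // subr_le0 ler_nat ltnW.
  by move=> <-; apply: eq_bigr => j _; rewrite /t [_ / _ * (_ * _)]mulrA divfK.
have m1 : 1 - \sum_(j < H.*2.+1) c j * cos (N%:R^-1 * t j) <= N%:R^-1.
  have h1 : (N + 1 <= H.*2.+1)%N by rewrite /H; lia.
  have := cE 1%N h1.
  have -> : \sum_(j < H.*2.+1) c j * cos (1%:R * ((j%:R - H%:R) * (2 * pi / H.*2.+1%:R)))
    = \sum_(j < H.*2.+1) c j * cos (N%:R^-1 * t j).
    by apply: eq_bigr => j _; rewrite /t mulKf // mul1r.
  move=> ->; rewrite natrB // mulrBl divff // mul1r; lra.
have -> : \sum_(j < H.*2.+1) c j * cos (x * t j) =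
          \sum_(j < H.*2.+1) c j * cos (`|x| * t j).
  by apply: eq_bigr => j _; case: ger0P => // _; rewrite mulNr cosN.
have -> : tri x = tri `|x| by rewrite /tri normr_id.
have h1 := sum_cos_modulus c0 c1 tpi xy eta0; rewrite mk in h1.
have h2 := tri_lip (k%:R / N%:R) `|x|; rewrite distrC in h2.
have h3 : (1 - \sum_(j < H.*2.+1) c j * cos (N%:R^-1 * t j)) / (2 * eta) <= eta.
  rewrite ler_pdivrMr ?mulr_gt0 //; apply: le_trans m1 _.
  rewrite -[leRHS]invrK lef_pV2 ?posrE ?invr_gt0 ?mulr_gt0 //.
  have -> : (eta * (2 * eta))^-1 = eta^-2 / 2 by field; rewrite gt_eqF.
  have i1 : 0 < eta^-1 by rewrite invr_gt0.
  have i2 : 0 < eta^-2 by rewrite invr_gt0 exprn_gt0.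
  lra.
have h4 : N%:R^-1 <= eta.
  rewrite -[leRHS]invrK lef_pV2 ?posrE ?invr_gt0 //.
  have i2 : 0 < eta^-2 by rewrite invr_gt0 exprn_gt0.
  lra.
rewrite distrC in xy.
have -> : e = eta + eta + eta by rewrite /eta; field.
apply: le_trans (ler_distD (tri (k%:R / N%:R)) _ _) _.
apply: lerD; first exact: le_trans h1 (lerD (lexx _) h3).
rewrite distrC in h2.
exact: le_trans h2 (le_trans xy h4).
Qed.

(** * Fourier multipliers *)

Lemma normc_ge0 (R : rcfType) (z : R[i]) : 0 <= normc z.
Proof. by case: z => a b; rewrite sqrtr_ge0. Qed.

Lemma normc_conj (R : rcfType) (z : R[i]) : normc z^* = normc z.
Proof. by case: z => a b; rewrite /= sqrrN. Qed.

Lemma normc_real (R : rcfType) (x : R) : normc x%:C = `|x|.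
Proof. by rewrite /= expr0n addr0 sqrtr_sqr. Qed.

Lemma normc_sqr (R : rcfType) (z : R[i]) :
  normc z ^+ 2 = complex.Re z ^+ 2 + complex.Im z ^+ 2.
Proof. by case: z => a b /=; rewrite sqr_sqrtr // addr_ge0 // sqr_ge0. Qed.

Lemma ler_norm_Re (R : rcfType) (z : R[i]) : `|complex.Re z| <= normc z.
Proof.
rewrite -(@ler_pXn2r _ 2) ?nnegrE ?normc_ge0 // normc_sqr real_normK ?num_real //.
by rewrite lerDl sqr_ge0.
Qed.

Lemma ler_norm_Im (R : rcfType) (z : R[i]) : `|complex.Im z| <= normc z.
Proof.
rewrite -(@ler_pXn2r _ 2) ?nnegrE ?normc_ge0 // normc_sqr real_normK ?num_real //.
by rewrite lerDr sqr_ge0.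
Qed.

Lemma ler_Re_normc (R : rcfType) (z : R[i]) : complex.Re z <= normc z.
Proof. exact: le_trans (ler_norm _) (ler_norm_Re z). Qed.

Lemma normc_le_ReIm (R : rcfType) (z : R[i]) :
  normc z <= `|complex.Re z| + `|complex.Im z|.
Proof.
rewrite -(@ler_pXn2r _ 2) ?nnegrE ?normc_ge0 ?addr_ge0 //.
rewrite normc_sqr sqrrD !real_normK ?num_real // lerD2r lerDl.
by rewrite mulrn_wge0 ?mulr_ge0.
Qed.

Lemma mulcJ_normc (R : rcfType) (z : R[i]) : z * z^* = (normc z ^+ 2)%:C.
Proof.
rewrite normc_sqr; case: z => a b /=; apply/eqP; rewrite eq_complex /=.
by apply/andP; split; apply/eqP; ring.
Qed.

Lemma normcB (R : rcfType) (x y : R[i]) : normc (x - y) <= normc x + normc y.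
Proof. by rewrite -(normcN y); exact: (le_normcD x (- y)). Qed.

Lemma normc_distC (R : rcfType) (x y : R[i]) : normc (x - y) = normc (y - x).
Proof. by rewrite -normcN opprB. Qed.

Lemma normc_sum (R : rcfType) (I : Type) (s : seq I) (F : I -> R[i]) :
  normc (\sum_(i <- s) F i) <= \sum_(i <- s) normc (F i).
Proof.
elim/big_ind2: _ => [|x a y b xa yb|//]; first by rewrite normc0.
by apply: le_trans (le_normcD _ _) _; rewrite lerD.
Qed.

(** * Atomic measures on the line and pointwise limits of their transforms *)

Definition cis (R : realType) (u : R) : R[i] := cos u +i* sin u.

Lemma cisD (R : realType) (u v : R) : cis (u + v) = cis u * cis v.
Proof.
by rewrite /cis cosD sinD; apply/eqP; rewrite eq_complex /= eqxx /=; apply/eqP; ring.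
Qed.

Lemma normc_cis (R : realType) (u : R) : normc (cis u) = 1.
Proof. by rewrite /= cos2Dsin2 sqrtr1. Qed.

Lemma cis0 (R : realType) : cis 0 = 1 :> R[i].
Proof. by rewrite /cis cos0 sin0. Qed.

(* The finite measure sum c_j delta_(t_j), given by the pairs (c_j, t_j). *)
Definition atomic_symbol (R : realType) (s : seq (R[i] * R)) (x : R) : R[i] :=
  \sum_(i <- s) i.1 * cis (x * i.2).

Definition atomic_mass (R : realType) (s : seq (R[i] * R)) : R :=
  \sum_(i <- s) normc i.1.

(** The pointwise closure of the transforms of atomic measures of mass at most [C]. Approximation on
    finite sets avoids any topology on measures, makes the closure properties below elementary, and
    is all that the duality argument asks for. *)
Definition is_multiplier (R : realType) (phi : R -> R) (C : R) : Prop :=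
  forall (X : seq R) (e : R), 0 < e -> exists s : seq (R[i] * R),
    atomic_mass s <= C /\
    {in X, forall x, normc (atomic_symbol s x - (phi x)%:C) <= e}.

Lemma atomic_mass_ge0 (R : realType) (s : seq (R[i] * R)) : 0 <= atomic_mass s.
Proof. by apply: sumr_ge0 => i _; exact: normc_ge0. Qed.

Lemma normc_atomic_symbol (R : realType) (s : seq (R[i] * R)) x :
  normc (atomic_symbol s x) <= atomic_mass s.
Proof.
apply: le_trans (normc_sum _ _) _.
by apply: ler_sum => i _; rewrite normcM normc_cis mulr1.
Qed.

Lemma multiplier_ge0 (R : realType) (phi : R -> R) C :
  is_multiplier phi C -> 0 <= C.
Proof.
by move=> /(_ [::] 1 ltr01)[s [sC _]]; exact: le_trans (atomic_mass_ge0 s) sC.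
Qed.

Lemma multiplier_bound (R : realType) (phi : R -> R) C x :
  is_multiplier phi C -> `|phi x| <= C.
Proof.
move=> hphi; apply/ler_addgt0Pr => e e0.
have [s [sC /(_ x)]] := hphi [:: x] e e0; rewrite mem_head => /(_ isT) h.
rewrite -normc_real -(subKr (atomic_symbol s x) (phi x)%:C).
apply: le_trans (normcB _ _) (lerD _ h).
exact: le_trans (normc_atomic_symbol _ _) sC.
Qed.

Lemma multiplier_ext (R : realType) (phi psi : R -> R) C :
  is_multiplier phi C -> phi =1 psi -> is_multiplier psi C.
Proof. by move=> h /funext <-. Qed.

Lemma multiplier_le (R : realType) (phi : R -> R) C D :
  is_multiplier phi C -> C <= D -> is_multiplier phi D.
Proof.
move=> h CD X e e0; have [s [sC hs]] := h X e e0.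
by exists s; split => //; exact: le_trans sC CD.
Qed.

Lemma multiplier_lim (R : realType) (phi : R -> R) C :
  (forall (X : seq R) e, 0 < e -> exists psi, is_multiplier psi C /\
     {in X, forall x, `|psi x - phi x| <= e}) ->
  is_multiplier phi C.
Proof.
move=> h X e e0; have e20 : 0 < e / 2 by rewrite divr_gt0.
have [psi [hpsi hX]] := h X _ e20; have [s [sC hs]] := hpsi X _ e20.
exists s; split => // x xX.
rewrite -(subrKA (psi x)%:C); apply: le_trans (le_normcD _ _) _.
rewrite [e](splitr e); apply: lerD; first exact: hs.
by rewrite -rmorphB normc_real hX.
Qed.

Lemma multiplierD (R : realType) (phi psi : R -> R) C D :
  is_multiplier phi C -> is_multiplier psi D ->
  is_multiplier (fun x => phi x + psi x) (C + D).
Proof.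
move=> h1 h2 X e e0; have e20 : 0 < e / 2 by rewrite divr_gt0.
have [s [sC hs]] := h1 X _ e20; have [r [rC hr]] := h2 X _ e20.
exists (s ++ r); split => [|x xX].
  by rewrite /atomic_mass big_cat lerD.
rewrite /atomic_symbol big_cat /= rmorphD opprD addrACA.
apply: le_trans (le_normcD _ _) _; rewrite [e](splitr e).
by apply: lerD; [exact: hs | exact: hr].
Qed.

Lemma multiplierZ (R : realType) (phi : R -> R) C a :
  is_multiplier phi C -> is_multiplier (fun x => a * phi x) (`|a| * C).
Proof.
move=> h X e e0; have a0 : 0 < `|a| + 1 by rewrite ltr_wpDl.
have [s [sC hs]] := h X (e / (`|a| + 1)) (divr_gt0 e0 a0).
exists [seq (a%:C * i.1, i.2) | i <- s]; split => [|x xX].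
  rewrite /atomic_mass big_map /=.
  under eq_bigr => i _ do rewrite normcM normc_real.
  by rewrite -mulr_sumr ler_wpM2l.
rewrite /atomic_symbol big_map /=.
under eq_bigr => i _ do rewrite -mulrA.
rewrite -mulr_sumr rmorphM -mulrBr normcM normc_real.
apply: le_trans (ler_wpM2l (normr_ge0 _) (hs x xX)) _.
by rewrite mulrA ler_pdivrMr // mulrC ler_wpM2l ?(ltW e0) // lerDl.
Qed.

(** Translating the symbol multiplies each atom by a unimodular factor, which leaves the mass
    unchanged. *)
Lemma multiplier_shift (R : realType) (phi : R -> R) C a :
  is_multiplier phi C -> is_multiplier (fun x => phi (x - a)) C.
Proof.
move=> h X e e0; have [s [sC hs]] := h [seq x - a | x <- X] e e0.
exists [seq (i.1 * cis (- a * i.2), i.2) | i <- s]; split => [|x xX].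
  rewrite /atomic_mass big_map /=.
  by under eq_bigr => i _ do rewrite normcM normc_cis mulr1.
have := hs _ (map_f (fun x => x - a) xX) => /=.
rewrite /atomic_symbol big_map /=.
by under eq_bigr => i _ do rewrite mulrBl addrC cisD -mulNr mulrA.
Qed.

Lemma multiplier1 (R : realType) : is_multiplier (fun=> 1 : R) 1.
Proof.
move=> X e e0; exists [:: (1, 0)]; split => [|x _].
  by rewrite /atomic_mass big_seq1 normc1.
have -> : atomic_symbol [:: (1, 0)] x = 1.
    by rewrite /atomic_symbol big_seq1 [X in cis X]mulr0 cis0 mulr1.
  by rewrite subrr normc0 ltW.
Qed.

Lemma multiplierM (R : realType) (phi psi : R -> R) C D :
  is_multiplier phi C -> is_multiplier psi D ->
  is_multiplier (fun x => phi x * psi x) (C * D).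
Proof.
move=> h1 h2 X e e0.
have C0 := multiplier_ge0 h1; have D0 := multiplier_ge0 h2.
pose d := e / (C + D + 1).
have CD0 : 0 < C + D + 1 by rewrite ltr_wpDl // addr_ge0.
have d0 : 0 < d by rewrite divr_gt0.
have [s [sC hs]] := h1 X _ d0; have [r [rC hr]] := h2 X _ d0.
(* This is the convolution of the two measures: symbols multiply and so do the masses. *)
exists [seq (i.1 * j.1, i.2 + j.2) | i <- s, j <- r]; split => [|x xX].
  rewrite /atomic_mass big_allpairs_dep /=.
  under eq_bigr => i _ do under eq_bigr => j _ do rewrite normcM.
  under eq_bigr => i _ do rewrite -mulr_sumr.
  by rewrite -mulr_suml ler_pM //; exact: atomic_mass_ge0.
have -> : atomic_symbol [seq (i.1 * j.1, i.2 + j.2) | i <- s, j <- r] x =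
          atomic_symbol s x * atomic_symbol r x.
  rewrite /atomic_symbol big_allpairs_dep /= big_distrlr /=.
  by apply: eq_bigr => i _; apply: eq_bigr => j _; rewrite mulrDr cisD mulrACA.
set S := atomic_symbol s x; set T := atomic_symbol r x.
have -> : S * T - (phi x * psi x)%:C =
    S * (T - (psi x)%:C) + (S - (phi x)%:C) * (psi x)%:C.
  by rewrite rmorphM; ring.
apply: le_trans (le_normcD _ _) _; rewrite !normcM normc_real.
apply: (@le_trans _ _ (C * d + d * D)).
  apply: lerD; apply: ler_pM; rewrite ?normc_ge0 ?normr_ge0 //.
  - exact: le_trans (normc_atomic_symbol _ _) sC.
  - exact: hr.
  - exact: hs.
  - exact: multiplier_bound h2.
rewrite [d * D]mulrC -mulrDl /d mulrA ler_pdivrMr // mulrC ler_wpM2l ?(ltW e0) //.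
by rewrite lerDl.
Qed.

Lemma multiplierX (R : realType) (phi : R -> R) C n :
  is_multiplier phi C -> is_multiplier (fun x => phi x ^+ n) (C ^+ n).
Proof.
move=> h; elim: n => [|n IHn].
  exact: multiplier_ext (@multiplier1 R) _.
rewrite exprS; apply: multiplier_ext (multiplierM h IHn) _ => x.
by rewrite exprS.
Qed.

Lemma multiplier_sum (R : realType) (phi : nat -> R -> R) C n :
  (forall k, is_multiplier (phi k) (C k)) ->
  is_multiplier (fun x => \sum_(k < n) phi k x) (\sum_(k < n) C k).
Proof.
move=> h; elim: n => [|n IHn].
  rewrite big_ord0 => X e e0; exists [::]; split => [|x _].
    by rewrite /atomic_mass big_nil.
  by rewrite /atomic_symbol big_nil big_ord0 subrr normc0 ltW.
rewrite big_ord_recr; apply: multiplier_ext (multiplierD IHn (h n)) _ => x.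
by rewrite big_ord_recr.
Qed.

Lemma expR_partial_sum_le (R : realType) (C : R) n : 0 <= C ->
  \sum_(k < n) C ^+ k / k`!%:R <= expR C.
Proof.
move=> C0.
have := @nondecreasing_cvgn_le R (series (exp_coeff C)) _ (is_cvg_series_exp_coeff C) n.
rewrite /series /= big_mkord; apply.
apply: (@nondecreasing_series R (exp_coeff C) xpredT 0) => i _.
by move=> _; exact: exp_coeff_ge0.
Qed.

(** The partial sums of the exponential series have mass at most the partial sums of [expR C]. They
    converge pointwise, hence uniformly on a finite set. *)
Lemma multiplier_exp (R : realType) (phi : R -> R) C :
  is_multiplier phi C -> is_multiplier (fun x => expR (phi x)) (expR C).
Proof.
move=> h; have C0 := multiplier_ge0 h.
have hn n : is_multiplier (fun x => \sum_(k < n) phi x ^+ k / k`!%:R) (expR C).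
  apply: multiplier_le _ (expR_partial_sum_le n C0).
  apply: (@multiplier_sum _ (fun k x => phi x ^+ k / k`!%:R)
    (fun k => C ^+ k / k`!%:R)) => k.
  have := multiplierZ k`!%:R^-1 (multiplierX k h).
  rewrite ger0_norm // mulrC; move=> /multiplier_ext; apply=> x.
  by rewrite mulrC.
apply: multiplier_lim => X e e0.
suff [N hN] : exists N, forall n, (N <= n)%N -> {in X, forall x,
    `|\sum_(k < n) phi x ^+ k / k`!%:R - expR (phi x)| <= e}.
  by exists (fun x => \sum_(k < N) phi x ^+ k / k`!%:R); split; [|exact: hN].
elim: X => [|y X [N hN]]; first by exists 0%N.
have /cvgrPdist_le /(_ e e0) [M _ hM] := is_cvg_series_exp_coeff (phi y).
exists (maxn N M) => n; rewrite geq_max => /andP[Nn Mn] x.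
rewrite inE => /predU1P[->|xX]; last exact: hN.
by have := hM n Mn; rewrite distrC /series /= big_mkord.
Qed.

Lemma multiplier_tri (R : realType) : is_multiplier (@tri R) 1.
Proof.
move=> X e e0.
pose M := \sum_(x <- X) `|x|.
have [n [c [t [c0 c1 hn]]]] := tri_cos_approx M e0.
(* The cosine is the mean of [cis (x * t)] and [cis (- (x * t))], so each weight is split evenly
   between the atoms at [t j] and [- t j]. *)
pose f (d : R) j : R[i] * R := ((c j / 2)%:C, d * t j).
exists ([seq f 1 j | j <- iota 0 n] ++ [seq f (-1) j | j <- iota 0 n]).
have c20 j : 0 <= c j / 2 by rewrite divr_ge0.
have E (V : zmodType) (g : nat -> V) :
    \sum_(j <- iota 0 n) g j = \sum_(j < n) g j.
  by rewrite -[n in iota 0 n]subn0 -/(index_iota 0 n) big_mkord.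
split => [|x xX].
  rewrite /atomic_mass big_cat !big_map /= -big_split /=.
  rewrite E -[leRHS]c1; apply: ler_sum => j _.
  by rewrite expr0n addr0 sqrtr_sqr ger0_norm // -splitr.
have -> : atomic_symbol
    ([seq f 1 j | j <- iota 0 n] ++ [seq f (-1) j | j <- iota 0 n]) x =
    (\sum_(j < n) c j * cos (x * t j))%:C.
  rewrite /atomic_symbol big_cat /= !big_map -big_split E /=.
  rewrite rmorph_sum; apply: eq_bigr => j _.
  rewrite mul1r mulN1r mulrN /cis cosN sinN.
  by apply/eqP; rewrite eq_complex /=; apply/andP; split; apply/eqP; field.
rewrite -rmorphB normc_real; apply: hn.
by rewrite /M (big_rem x) //= lerDl sumr_ge0.
Qed.

(** Hats centred at 1 and -1 make the unbounded function [y] agree on [-1, 1] with a multiplier of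
    mass 2. *)
Lemma tri_saw (R : realType) (y : R) : `|y| <= 1 -> tri (y - 1) - tri (y + 1) = y.
Proof.
rewrite ler_norml => /andP[a b].
rewrite /tri (@ler0_norm _ (y - 1)) ?subr_le0 // (@ger0_norm _ (y + 1)); last first.
  by rewrite -lerBlDr sub0r.
case: (ltP 0 (1 - (- (y - 1)))) => ?; case: (ltP 0 (1 - (y + 1))) => ?; lra.
Qed.

Definition block (R : realType) (sigma : R) (k : nat) (x : R) : R :=
  expR (- (x * sigma)) * tri (x - k%:R).

(* On the support of [tri (x - k)] the identity [x - k] is a difference of two
   translates of [tri], whose exponential is again a multiplier. *)
Lemma multiplier_block (R : realType) (sigma : R) (k : nat) : 0 <= sigma ->
  is_multiplier (block sigma k) (expR (- (k%:R * sigma)) * expR (sigma * 2)).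
Proof.
move=> s0.
have htri : is_multiplier (fun x : R => tri (x - k%:R)) 1.
  exact: multiplier_shift (@multiplier_tri R).
have hsaw : is_multiplier
    (fun x : R => - sigma * (tri (x - k%:R - 1) + (-1) * tri (x - k%:R - (-1))))
    (`|- sigma| * (1 + `|-1| * 1)).
  apply: multiplierZ; apply: multiplierD.
    exact: (@multiplier_shift _ (fun x => tri (x - 1)) _ k%:R
             (multiplier_shift 1 (@multiplier_tri R))).
  apply: multiplierZ.
  exact: (@multiplier_shift _ (fun x => tri (x - (-1))) _ k%:R
           (multiplier_shift (-1) (@multiplier_tri R))).
(* Origin of the factor e^(2 sigma): the sawtooth is a difference of two hats of mass 1 and is
   scaled by [- sigma] before exponentiation. *)
have -> : sigma * 2 = `|- sigma| * (1 + `|-1| * 1).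
  by rewrite !normrN normr1 ger0_norm // mulr1.
rewrite -[X in is_multiplier _ (X * _)]ger0_norm ?expR_ge0 //.
rewrite -[X in is_multiplier _ (_ * X)]mul1r.
apply: multiplier_ext (multiplierZ _ (multiplierM htri (multiplier_exp hsaw))) _.
move=> x /=; rewrite /block.
(* Outside this interval the sawtooth is no longer [x - k], but the factor [tri (x - k)] vanishes
   there. *)
have [x1|x1] := leP `|x - k%:R| 1; last first.
  by rewrite /tri max_l ?mul0r ?mulr0 // subr_le0 ltW.
rewrite opprK mulN1r tri_saw // mulrCA -expRD mulrC; congr (expR _ * _); ring.
Qed.

(** The closed form is 1 up to [n - 1] and then falls linearly to 0 at [n]; adding the next hat
    fills exactly this ramp. For [x >= 0] no hat with a negative centre contributes. *)
Lemma sum_tri (R : realType) (x : R) n : 0 <= x ->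
  \sum_(k < n) tri (x - k%:R) = Num.min 1 (Num.max 0 (n%:R - x)).
Proof.
move=> x0; elim: n => [|n IHn].
  by rewrite big_ord0 sub0r max_l ?oppr_le0 // min_r // ler01.
rewrite big_ord_recr /= IHn /tri -natr1 distrC.
have -> : n%:R + 1 - x = (n%:R - x) + 1 by ring.
set z := _ - x.
by case: (ger0P z) => ?; case: (leP 0 z) => ?; case: (leP 0 (z + 1)) => ?;
  case: (leP 0 (1 - z)) => ?; case: (leP 1 z) => ?; case: (leP 1 (z + 1)) => ?;
  case: (leP 0 (1 - - z)) => ?; rewrite ?minElt ?ltr10; lra.
Qed.

Lemma sum_block (R : realType) (sigma x : R) n : 0 <= x -> x + 1 <= n%:R ->
  \sum_(k < n) block sigma k x = expR (- (x * sigma)).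
Proof.
move=> x0 xn; rewrite /block -mulr_sumr sum_tri // min_l ?mulr1 //.
by rewrite le_max lerBrDl xn orbT.
Qed.

Lemma block_eq0 (R : realType) (sigma x : R) k : k%:R + 1 <= x -> block sigma k x = 0.
Proof.
move=> kx; rewrite /block /tri max_l ?mulr0 // subr_le0.
by apply: le_trans (ler_norm _); rewrite lerBrDl.
Qed.

(** * Polynomial approximation of the weight used in the duality argument *)

(* The recursion is Pascal's rule for the Bernstein basis. *)
Fixpoint bernstein (R : realType) (n : nat) (f : nat -> R) : {poly R} :=
  if n is n'.+1 then
    'X * bernstein n' (fun k => f k.+1) + (1 - 'X) * bernstein n' f
  else (f 0%N)%:P.

(** The value at [x] is the expectation of [f S] for a binomial variable [S] with parameters [n] and
    [x], and the bracket on the right is the expectation of [(S - c)^2]: variance plus squared bias.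
    The centre [c] is free because shifting [f] by one in the recursion replaces it by [c - 1]. *)
Lemma bernstein_bound (R : realType) (n : nat) (f : nat -> R) (x a A B c : R) :
  0 <= x <= 1 -> (forall k, (k <= n)%N -> `|f k - a| <= A + B * (k%:R - c) ^+ 2) ->
  `|(bernstein n f).[x] - a| <=
    A + B * (n%:R * x * (1 - x) + (n%:R * x - c) ^+ 2).
Proof.
move=> /andP[x0 x1]; elim: n f c => [|n IHn] f c hf /=.
  rewrite hornerC; have := hf 0%N isT.
  congr (_ <= _ + _ * _); ring.
have h0 := IHn f c (fun k kn => hf k (leqW kn)).
have h1 : `|(bernstein n (fun k => f k.+1)).[x] - a| <=
    A + B * (n%:R * x * (1 - x) + (n%:R * x - (c - 1)) ^+ 2).
  apply: IHn => k kn; have := hf k.+1 kn.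
  by have -> : k.+1%:R - c = k%:R - (c - 1) by rewrite -natr1; ring.
rewrite !hornerE.
set u := (bernstein n f).[x] in h0 *; set v := (bernstein n _).[x] in h1 *.
have -> : x * v + (1 - x) * u - a = x * (v - a) + (1 - x) * (u - a) by ring.
apply: le_trans (ler_normD _ _) _; rewrite !normrM (ger0_norm x0).
rewrite (@ger0_norm _ (1 - x)) ?subr_ge0 //.
apply: le_trans (lerD (ler_wpM2l x0 h1) (ler_wpM2l _ h0)) _; first by rewrite subr_ge0.
by rewrite -natr1 le_eqVlt; apply/orP; left; apply/eqP; ring.
Qed.

Lemma lipschitz_poly_approx (R : realType) (F : R -> R) (K e : R) : 0 < K -> 0 < e ->
  (forall x y, 0 <= x <= 1 -> 0 <= y <= 1 -> `|F x - F y| <= K * `|x - y|) ->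
  exists r : {poly R}, forall x, 0 <= x <= 1 -> `|r.[x] - F x| <= e.
Proof.
move=> K0 e0 hF.
pose eta := e / (2 * K).
have eta0 : 0 < eta by rewrite divr_gt0 ?mulr_gt0.
pose n := (Num.truncn (K / eta * 2 / e)).+1.
have nK : K / eta * 2 / e < n%:R by exact: truncnS_gt.
have n0 : 0 < n%:R :> R by rewrite ltr0n.
exists (bernstein n (fun k => F (k%:R / n%:R))) => x x01.
have /andP[x0 x1] := x01.
(* The Lipschitz bound becomes quadratic through [|u| <= eta + u^2 / eta]. The choice of [eta] makes
   the constant term [e / 2], and [n] makes the variance term at most [e / 2]. *)
have hk k : (k <= n)%N -> `|F (k%:R / n%:R) - F x| <=
    K * eta + K / eta / n%:R ^+ 2 * (k%:R - n%:R * x) ^+ 2.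
  move=> kn; apply: le_trans (hF _ _ _ x01) _.
    by rewrite divr_ge0 //= ler_pdivrMr // mul1r ler_nat.
  have -> : K * eta + K / eta / n%:R ^+ 2 * (k%:R - n%:R * x) ^+ 2 =
    K * (eta + (k%:R / n%:R - x) ^+ 2 / eta) by field; rewrite !gt_eqF.
  rewrite ler_pM2l // -(ler_pM2r eta0) mulrDl divfK ?gt_eqF //.
  set u := _ - x; rewrite -(real_normK (num_real u)).
  by have := sqr_ge0 (eta - `|u|); have := normr_ge0 u; nra.
apply: le_trans (bernstein_bound x01 hk) _.
rewrite subrr expr0n addr0.
have -> : K / eta / n%:R ^+ 2 * (n%:R * x * (1 - x)) = K / eta / n%:R * (x * (1 - x)).
  by field; rewrite !gt_eqF.
have h1 : K * eta = e / 2 by rewrite /eta; field; rewrite gt_eqF.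
have C0 : 0 <= K / eta / n%:R.
  by apply: divr_ge0 => //; apply: divr_ge0; exact: ltW.
have h2 : K / eta / n%:R * (x * (1 - x)) <= K / eta / n%:R.
  by rewrite ler_piMr // mulr_ile1 ?subr_ge0 // gerBl.
have h3 : K / eta / n%:R <= e / 2.
  by rewrite ler_pdivrMr //; move: nK; rewrite ltr_pdivrMr // => nK; lra.
lra.
Qed.

(** With [t = (x + d) / (y + d)] in (0, 1], the difference is [(x + d)^(-a) (1 - t^a)] for [x <= y].
    As [a <= 1], one has [t <= t^a], so the last factor is at most [1 - t = (y - x) / (y + d)]. *)
Lemma powR_shift_lipschitz (R : realType) (d a x y : R) : 0 < d -> 0 <= a <= 1 ->
  0 <= x -> 0 <= y ->
  `|(x + d) `^ (- a) - (y + d) `^ (- a)| <= d `^ (- a) / d * `|x - y|.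
Proof.
move=> d0 /andP[a0 a1].
wlog xy : x y / x <= y => [hw x0 y0|x0 y0].
  have [xy|/ltW yx] := leP x y; first exact: hw.
  by rewrite distrC [`|x - y|]distrC; exact: hw.
have xd : 0 < x + d by rewrite ltr_wpDl.
have yd : 0 < y + d by rewrite ltr_wpDl.
rewrite [`|x - y|]distrC (@ger0_norm _ (y - x)) ?subr_ge0 //.
have E : (y + d) `^ (- a) = (x + d) `^ (- a) * ((x + d) / (y + d)) `^ a.
  rewrite powRM ?invr_ge0 ?(ltW xd) ?(ltW yd) // mulrA -powRD; last first.
    by rewrite (gt_eqF xd) implybT.
  rewrite addNr powRr0 mul1r -powR_inv1 ?(ltW yd) // -powRrM; congr powR; ring.
have t01 : 0 < (x + d) / (y + d) <= 1.
  by rewrite divr_gt0 //= ler_pdivrMr // mul1r lerD2r.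
have ht : (x + d) / (y + d) <= ((x + d) / (y + d)) `^ a.
  exact: ger1_powR.
have ht1 : ((x + d) / (y + d)) `^ a <= 1.
  have /andP[t0 t1] := t01.
  have <- : 1 `^ a = 1 :> R by rewrite powR1.
  by rewrite ge0_ler_powR // nnegrE ltW.
have p0 : 0 <= (x + d) `^ (- a) := powR_ge0 _ _.
rewrite E -{1}[(x + d) `^ (- a)]mulr1 -mulrBr ger0_norm; last first.
  by rewrite mulr_ge0 // subr_ge0.
have h1 : (x + d) `^ (- a) <= d `^ (- a).
  rewrite !powRN lef_pV2 ?posrE ?powR_gt0 //.
  by rewrite ge0_ler_powR ?nnegrE ?(ltW d0) ?(ltW xd) // lerDr.
have h2 : 1 - ((x + d) / (y + d)) `^ a <= d^-1 * (y - x).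
  apply: (@le_trans _ _ (1 - (x + d) / (y + d))); first by rewrite lerB.
  have -> : 1 - (x + d) / (y + d) = (y + d)^-1 * (y - x) by field; rewrite gt_eqF.
  by rewrite ler_wpM2r ?subr_ge0 // lef_pV2 ?posrE // lerDr.
by rewrite -mulrA ler_pM // subr_ge0.
Qed.

(** A polynomial in |Q|^2 is again a trigonometric polynomial, unlike the power it replaces.
    Approximating from below by non-negative values lets the test function inherit the upper bound
    of the exact weight without an error term. *)
Lemma powR_poly_approx_below (R : realType) (d a M e : R) :
  0 < d -> 0 <= a <= 1 -> 0 < M -> 0 < e ->
  exists r : {poly R}, forall s, 0 <= s <= M ->
    0 <= r.[s] <= (s + d) `^ (- a) /\ (s + d) `^ (- a) <= r.[s] + e.
Proof.
move=> d0 a01 M0 e0; have /andP[a0 a1] := a01.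
pose m := (M + d) `^ (- a).
have Md : 0 < M + d by rewrite addr_gt0.
have m0 : 0 < m by rewrite powR_gt0.
(* An approximation within [h], lowered by [h], lies between the power minus [2 * h] and the power.
   It stays non-negative because [2 * h <= m], the least value of the power on [0, M]. *)
pose h := Num.min e m / 2.
have h0 : 0 < h by rewrite divr_gt0 // lt_min e0.
pose K := d `^ (- a) / d * M.
have K0 : 0 < K by rewrite mulr_gt0 // divr_gt0 // powR_gt0.
have [|r hr] := @lipschitz_poly_approx R (fun x => (M * x + d) `^ (- a)) K h K0 h0.
  move=> x y /andP[x0 _] /andP[y0 _].
  have Mx : 0 <= M * x by rewrite mulr_ge0 // ltW.
  have My : 0 <= M * y by rewrite mulr_ge0 // ltW.
  apply: le_trans (powR_shift_lipschitz d0 a01 Mx My) _.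
  by rewrite -mulrBr normrM (gtr0_norm M0) mulrA.
exists ((r \Po (M^-1 *: 'X)) - h%:P) => s /andP[s0 sM].
have hs : 0 <= s / M <= 1 by rewrite divr_ge0 ?(ltW M0) //= ler_pdivrMr // mul1r.
have sE : M * (s / M) = s by rewrite mulrC divfK ?gt_eqF.
have := hr _ hs; rewrite sE.
rewrite hornerD horner_comp hornerZ hornerX hornerN hornerC [M^-1 * s]mulrC.
set v := r.[_]; rewrite ler_norml => /andP[h1 h2].
have sd : 0 < s + d by rewrite ltr_wpDl.
have ms : m <= (s + d) `^ (- a).
  rewrite /m !powRN lef_pV2 ?posrE ?powR_gt0 //.
  by rewrite ge0_ler_powR ?nnegrE ?(ltW sd) ?(ltW Md) // lerD2r.
have he : 2 * h <= e by rewrite /h mulrC divfK // ge_min lexx.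
have hm : 2 * h <= m by rewrite /h mulrC divfK // ge_min lexx orbT.
by split; [apply/andP; split|]; lra.
Qed.

(** * Complex-valued integrals *)

Definition cmeasurable (d : measure_display) (T : measurableType d) (R : realType)
    (f : T -> R[i]) : Prop :=
  measurable_fun [set: T] (fun x => complex.Re (f x)) /\
  measurable_fun [set: T] (fun x => complex.Im (f x)).

Definition cintegrable (d : measure_display) (T : measurableType d) (R : realType)
    (m : {measure set T -> \bar R}) (f : T -> R[i]) : Prop :=
  m.-integrable [set: T] (EFin \o (fun x => complex.Re (f x))) /\
  m.-integrable [set: T] (EFin \o (fun x => complex.Im (f x))).

Lemma ReD (R : rcfType) (x y : R[i]) :
  complex.Re (x + y) = complex.Re x + complex.Re y.
Proof. by case: x; case: y. Qed.

Lemma ImD (R : rcfType) (x y : R[i]) :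
  complex.Im (x + y) = complex.Im x + complex.Im y.
Proof. by case: x; case: y. Qed.

Lemma ReM (R : rcfType) (x y : R[i]) :
  complex.Re (x * y) = complex.Re x * complex.Re y - complex.Im x * complex.Im y.
Proof. by case: x; case: y. Qed.

Lemma ImM (R : rcfType) (x y : R[i]) :
  complex.Im (x * y) = complex.Re x * complex.Im y + complex.Im x * complex.Re y.
Proof. by case: x; case: y. Qed.

Lemma complex_ext (R : rcfType) (x y : R[i]) :
  complex.Re x = complex.Re y -> complex.Im x = complex.Im y -> x = y.
Proof. by case: x; case: y => a b c e /= -> ->. Qed.

Lemma cmeasurable_cst (d : measure_display) (T : measurableType d) (R : realType)
  (c : R[i]) : cmeasurable ((fun=> c) : T -> R[i]).
Proof. by split; exact: measurable_cst. Qed.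

Lemma cmeasurableD (d : measure_display) (T : measurableType d) (R : realType)
    (f g : T -> R[i]) :
  cmeasurable f -> cmeasurable g -> cmeasurable (fun x => f x + g x).
Proof.
move=> [f1 f2] [g1 g2]; split.
  by under eq_fun do rewrite ReD; exact: measurable_funD.
by under eq_fun do rewrite ImD; exact: measurable_funD.
Qed.

Lemma cmeasurableM (d : measure_display) (T : measurableType d) (R : realType)
    (f g : T -> R[i]) :
  cmeasurable f -> cmeasurable g -> cmeasurable (fun x => f x * g x).
Proof.
move=> [f1 f2] [g1 g2]; split.
  under eq_fun do rewrite ReM.
  by apply: measurable_funB; exact: measurable_funM.
under eq_fun do rewrite ImM.
by apply: measurable_funD; exact: measurable_funM.
Qed.

Lemma cmeasurable_sum (d : measure_display) (T : measurableType d) (R : realType)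
    (I : Type) (s : seq I) (f : I -> T -> R[i]) :
  (forall i, cmeasurable (f i)) -> cmeasurable (fun x => \sum_(i <- s) f i x).
Proof.
move=> hf; elim: s => [|i s IH].
  by under eq_fun do rewrite big_nil; exact: cmeasurable_cst.
by under eq_fun do rewrite big_cons; exact: cmeasurableD.
Qed.

Lemma measurable_normc (d : measure_display) (T : measurableType d) (R : realType)
    (f : T -> R[i]) : cmeasurable f -> measurable_fun [set: T] (fun x => normc (f x)).
Proof.
move=> [f1 f2].
rewrite (_ : (fun x => _) =
    (fun x => (complex.Re (f x) ^+ 2 + complex.Im (f x) ^+ 2) `^ 2^-1)).
  apply: (measurableT_comp (measurable_powR _)).
  by apply: measurable_funD; exact: measurable_funX.
apply/funext => x; rewrite -normc_sqr powR12_sqrt ?sqr_ge0 // sqrtr_sqr.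
by rewrite ger0_norm // normc_ge0.
Qed.

Lemma cintegrable_measurable (d : measure_display) (T : measurableType d)
    (R : realType) (m : {measure set T -> \bar R}) (f : T -> R[i]) :
  cintegrable m f -> cmeasurable f.
Proof.
by move=> [/integrableP[f1 _] /integrableP[f2 _]]; split; apply/measurable_EFinP.
Qed.

Lemma integrable_le (d : measure_display) (T : measurableType d) (R : realType)
    (m : {measure set T -> \bar R}) (f g : T -> R) :
  measurable_fun [set: T] f -> (forall x, `|f x| <= g x) ->
  m.-integrable [set: T] (EFin \o g) -> m.-integrable [set: T] (EFin \o f).
Proof.
move=> mf fg; apply: le_integrable => //; first exact/measurable_EFinP.
move=> x _ /=; rewrite lee_fin; apply: le_trans (fg x) _; exact: ler_norm.
Qed.

Lemma cintegrable_le (d : measure_display) (T : measurableType d) (R : realType)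
    (m : {measure set T -> \bar R}) (f : T -> R[i]) (g : T -> R) :
  cmeasurable f -> (forall x, normc (f x) <= g x) ->
  m.-integrable [set: T] (EFin \o g) -> cintegrable m f.
Proof.
move=> [f1 f2] fg ig; split; apply: (integrable_le _ _ ig) => // x.
  exact: le_trans (ler_norm_Re _) (fg x).
exact: le_trans (ler_norm_Im _) (fg x).
Qed.

Lemma integrableD_EFin (d : measure_display) (T : measurableType d) (R : realType)
    (m : {measure set T -> \bar R}) (f g : T -> R) :
  m.-integrable [set: T] (EFin \o f) -> m.-integrable [set: T] (EFin \o g) ->
  m.-integrable [set: T] (EFin \o (fun x => f x + g x)).
Proof.
move=> mf mg; have := integrableD measurableT mf mg.
by apply: eq_integrable => // x _ /=; rewrite EFinD.
Qed.

Lemma integrableZ_EFin (d : measure_display) (T : measurableType d) (R : realType)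
    (m : {measure set T -> \bar R}) (f : T -> R) (k : R) :
  m.-integrable [set: T] (EFin \o f) ->
  m.-integrable [set: T] (EFin \o (fun x => k * f x)).
Proof.
move=> mf; have := integrableZl measurableT k mf.
by apply: eq_integrable => // x _ /=; rewrite EFinM.
Qed.

Lemma integrable_normc (d : measure_display) (T : measurableType d) (R : realType)
    (m : {measure set T -> \bar R}) (f : T -> R[i]) :
  cintegrable m f -> m.-integrable [set: T] (EFin \o (fun x => normc (f x))).
Proof.
move=> hf; have [f1 f2] := hf.
apply: (integrable_le (g := fun x => `|complex.Re (f x)| + `|complex.Im (f x)|)).
- exact/measurable_normc/(cintegrable_measurable hf).
- by move=> x; rewrite ger0_norm ?normc_ge0 // normc_le_ReIm.
- by apply: integrableD_EFin; exact: integrable_norm.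
Qed.

Lemma cintegrableD (d : measure_display) (T : measurableType d) (R : realType)
    (m : {measure set T -> \bar R}) (f g : T -> R[i]) :
  cintegrable m f -> cintegrable m g -> cintegrable m (fun x => f x + g x).
Proof.
move=> hf hg; apply: (cintegrable_le (g := fun x => normc (f x) + normc (g x))).
- by apply: cmeasurableD; [exact: cintegrable_measurable hf
                          |exact: cintegrable_measurable hg].
- by move=> x; exact: le_normcD.
- by apply: integrableD_EFin; exact: integrable_normc.
Qed.

Lemma cintegrableZ (d : measure_display) (T : measurableType d) (R : realType)
    (m : {measure set T -> \bar R}) (f : T -> R[i]) (c : R[i]) :
  cintegrable m f -> cintegrable m (fun x => c * f x).
Proof.
move=> hf; apply: (cintegrable_le (g := fun x => normc c * normc (f x))).
- apply: cmeasurableM; first exact: cmeasurable_cst.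
  exact: cintegrable_measurable hf.
- by move=> x; rewrite normcM.
- by apply: integrableZ_EFin; exact: integrable_normc.
Qed.

Lemma cintegrable0 (d : measure_display) (T : measurableType d) (R : realType)
    (m : {measure set T -> \bar R}) : cintegrable m (fun=> 0).
Proof. by split; exact: integrable0. Qed.

Lemma cintegrable_sum (d : measure_display) (T : measurableType d) (R : realType)
    (m : {measure set T -> \bar R}) (I : Type) (s : seq I) (f : I -> T -> R[i]) :
  (forall i, cintegrable m (f i)) -> cintegrable m (fun x => \sum_(i <- s) f i x).
Proof.
move=> hf; elim: s => [|i s IH].
  by under eq_fun do rewrite big_nil; exact: cintegrable0.
by under eq_fun do rewrite big_cons; exact: cintegrableD.
Qed.

Lemma cintegral0 (d : measure_display) (T : measurableType d) (R : realType)
    (m : {measure set T -> \bar R}) : cintegral m (fun=> 0) = 0.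
Proof. by rewrite /cintegral /= Rintegral_cst // mul0r. Qed.

Lemma cintegralD (d : measure_display) (T : measurableType d) (R : realType)
    (m : {measure set T -> \bar R}) (f g : T -> R[i]) :
  cintegrable m f -> cintegrable m g ->
  cintegral m (fun x => f x + g x) = cintegral m f + cintegral m g.
Proof.
move=> [f1 f2] [g1 g2]; apply: complex_ext; rewrite /cintegral /=.
  by under eq_Rintegral do rewrite ReD; exact: RintegralD.
by under eq_Rintegral do rewrite ImD; exact: RintegralD.
Qed.

Lemma cintegralZ (d : measure_display) (T : measurableType d) (R : realType)
    (m : {measure set T -> \bar R}) (f : T -> R[i]) (c : R[i]) :
  cintegrable m f -> cintegral m (fun x => c * f x) = c * cintegral m f.
Proof.
move=> [f1 f2]; apply: complex_ext; rewrite ?ReM ?ImM /cintegral /=.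
  under eq_Rintegral do rewrite ReM.
  rewrite RintegralB //; [|exact: integrableZ_EFin|exact: integrableZ_EFin].
  by rewrite !RintegralZl.
under eq_Rintegral do rewrite ImM.
rewrite RintegralD //; [|exact: integrableZ_EFin|exact: integrableZ_EFin].
by rewrite !RintegralZl.
Qed.

Lemma cintegral_sum (d : measure_display) (T : measurableType d) (R : realType)
    (m : {measure set T -> \bar R}) (I : Type) (s : seq I) (f : I -> T -> R[i]) :
  (forall i, cintegrable m (f i)) ->
  cintegral m (fun x => \sum_(i <- s) f i x) = \sum_(i <- s) cintegral m (f i).
Proof.
move=> hf; elim: s => [|i s IH].
  by under eq_fun do rewrite big_nil; rewrite big_nil cintegral0.
under eq_fun do rewrite big_cons.
rewrite big_cons cintegralD //; first by rewrite IH.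
exact: cintegrable_sum.
Qed.

Lemma eq_cintegral (d : measure_display) (T : measurableType d) (R : realType)
    (m : {measure set T -> \bar R}) (f g : T -> R[i]) :
  f =1 g -> cintegral m f = cintegral m g.
Proof. by move=> /funext ->. Qed.

Lemma Re_cintegral_le (d : measure_display) (T : measurableType d) (R : realType)
    (m : {measure set T -> \bar R}) (f : T -> R[i]) (g : T -> R) :
  cintegrable m f -> m.-integrable [set: T] (EFin \o g) ->
  (forall x, normc (f x) <= g x) ->
  complex.Re (cintegral m f) <= Rintegral m [set: T] g.
Proof.
move=> [f1 _] ig fg; apply: le_Rintegral => // x _.
exact: le_trans (ler_Re_normc _) (fg x).
Qed.

Lemma integrable_cst (d : measure_display) (T : measurableType d) (R : realType)
  (m : probability T R) (k : R) : m.-integrable [set: T] (EFin \o (fun=> k)).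
Proof. exact: finite_measure_integrable_cst. Qed.

Lemma Rintegral_prob_cst (d : measure_display) (T : measurableType d) (R : realType)
  (m : probability T R) (k : R) : Rintegral m [set: T] (fun=> k) = k.
Proof.
rewrite Rintegral_cst // (_ : fine _ = 1) ?mulr1 //.
by rewrite [X in fine X]probability_setT.
Qed.

Lemma powR_le_1D (R : realType) (x p q : R) : 0 <= x -> 0 <= p -> p <= q ->
  x `^ p <= 1 + x `^ q.
Proof.
move=> x0 p0 pq; have [x1|x1] := leP 1 x.
  by apply: le_trans (ler_powR x1 pq) _; rewrite lerDr.
apply: (@le_trans _ _ 1); last by rewrite lerDl powR_ge0.
have <- : 1 `^ p = 1 :> R by rewrite powR1.
by rewrite ge0_ler_powR // ?nnegrE ?ltW.
Qed.

Lemma ler_1D_powR (R : realType) (x q : R) : 0 <= x -> 1 <= q -> x <= 1 + x `^ q.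
Proof. by move=> x0 q1; rewrite -[leLHS]powRr1 //; exact: powR_le_1D. Qed.

Lemma in_Lp_integrable (d : measure_display) (T : measurableType d) (R : realType)
    (m : {measure set T -> \bar R}) (p : R) (f : T -> R[i]) : 0 < p ->
  in_Lp m p%:E f <->
  cmeasurable f /\ m.-integrable [set: T] (EFin \o (fun x => normc (f x) `^ p)).
Proof.
move=> p0.
have E : (Lnorm m p%:E (fun x => (complex.Re `|f x|)%:E) `^ p =
    \int[m]_x `|(normc (f x) `^ p)%:E|)%E.
  rewrite poweR_Lnorm ?gt_eqF //; apply: eq_integral => x _.
  have -> : complex.Re `|f x| = normc (f x) by [].
  by rewrite !abse_EFin poweR_EFin ger0_norm ?normc_ge0 // ger0_norm ?powR_ge0.
split=> [[f1 f2 fp]|[[f1 f2] /integrableP[_ fp]]].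
  split=> //; apply/integrableP; split.
    apply/measurable_EFinP; apply: (measurableT_comp (measurable_powR _)).
    exact: measurable_normc.
  by rewrite -E poweR_lty.
split=> //; apply: contraTT fp; rewrite -!leNgt !leye_eq => /eqP h.
by rewrite -E h poweRyr // (gt_eqF p0).
Qed.

Lemma in_Lp_cintegrable (d : measure_display) (T : measurableType d) (R : realType)
    (m : probability T R) (p : R) (f : T -> R[i]) : 1 <= p ->
  in_Lp m p%:E f -> cintegrable m f.
Proof.
move=> p1 /in_Lp_integrable[]; first exact: lt_le_trans p1.
move=> mf fp; apply: (cintegrable_le (g := fun x => 1 + normc (f x) `^ p)) => //.
  by move=> x; rewrite ler_1D_powR // normc_ge0.
exact: integrableD_EFin (integrable_cst m 1) fp.
Qed.

Lemma in_Linfty (d : measure_display) (T : measurableType d) (R : realType)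
    (m : {measure set T -> \bar R}) (f : T -> R[i]) (K : R) :
  cmeasurable f -> (forall x, normc (f x) <= K) -> in_Lp m +oo%E f.
Proof.
move=> [f1 f2] fK; split => //; rewrite unlock; case: ifPn => // _.
apply: (@le_lt_trans _ _ K%:E); last exact: ltry.
apply/ess_supP; apply: nearW => x; rewrite lee_fin /=.
by rewrite ger0_norm ?normc_ge0.
Qed.

(** * Characters and Haar measure *)

Lemma normCE (R : rcfType) (z : R[i]) : `|z| = (normc z)%:C.
Proof. by []. Qed.

Lemma near_normc (R : realType) (z : R[i]^o) (e : R) : 0 < e ->
  \forall w \near z, normc (z - w) < e.
Proof.
move=> e0; have e0' : 0 < (e%:C : R[i]^o) by rewrite ltcR.
have := @nbhsx_ballx _ R[i]^o z _ e0'; apply: (@filterS _ _ (nbhs_filter (z : R[i]^o))) => w.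
by rewrite /ball /= normCE ltcR.
Qed.

Lemma continuous_Re (R : realType) : continuous (@complex.Re R : R[i]^o -> R^o).
Proof.
move=> z; have F : Filter (nbhs z) by exact: (nbhs_filter (z : R[i]^o)).
apply/cvgrPdist_lt => e e0.
apply: (@filterS _ _ (nbhs_filter (z : R[i]^o)) _ _ _ (near_normc z e0)) => w.
by apply: le_lt_trans; have := ler_norm_Re (z - w); clear; case: z; case: w.
Qed.

Lemma continuous_Im (R : realType) : continuous (@complex.Im R : R[i]^o -> R^o).
Proof.
move=> z; have F : Filter (nbhs z) by exact: (nbhs_filter (z : R[i]^o)).
apply/cvgrPdist_lt => e e0.
apply: (@filterS _ _ (nbhs_filter (z : R[i]^o)) _ _ _ (near_normc z e0)) => w.
by apply: le_lt_trans; have := ler_norm_Im (z - w); clear; case: z; case: w.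
Qed.

Lemma continuous_conjc (R : realType) : continuous (@conjc R : R[i]^o -> R[i]^o).
Proof.
move=> z; have F : Filter (nbhs z) by exact: (nbhs_filter (z : R[i]^o)).
apply/cvgrPdist_lt => e e0.
have := @nbhsx_ballx _ R[i]^o z e e0; apply: (@filterS _ _ (nbhs_filter (z : R[i]^o))) => w.
by rewrite /ball /= !normCE -rmorphB normc_conj.
Qed.

Section characters.
Context (R : realType) (G : topologicalZmodType).
Implicit Types h : G -> R[i].

Lemma normc_character h x : is_character h -> normc (h x) = 1.
Proof. by case=> _ /(_ x) + _; rewrite normCE => -[]. Qed.

Lemma character_conj h : is_character h -> is_character (fun x => (h x)^*).
Proof.
move=> [hc h1 hM]; split=> [x|x|x y].
- exact: (@continuous_comp G R[i]^o R[i]^o h conjc x (hc x) (@continuous_conjc R _)).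
- by rewrite normCE normc_conj -normCE h1.
- by rewrite hM rmorphM.
Qed.

Lemma characterM h k : is_character h -> is_character k ->
  is_character (fun x => h x * k x).
Proof.
move=> [hc h1 hM] [kc k1 kM]; split=> [x|x|x y].
- by apply: (@cvgM R[i]); [exact: hc | exact: kc].
- by rewrite normrM h1 k1 mulr1.
- by rewrite hM kM mulrACA.
Qed.

End characters.

Lemma continuous_borel (R : realType) (G : topologicalZmodType) (f : G -> R) :
  continuous f -> measurable_fun [set: borel G] (f : borel G -> R).
Proof.
move=> cf; apply: (measurability _ (RGenOInfty.measurableE R)).
move=> _ [_ [x ->] <-]; rewrite setTI; apply: sub_sigma_algebra.
by move/continuousP : cf; apply; exact: interval_open.
Qed.

Lemma character_cmeasurable (R : realType) (G : topologicalZmodType) (h : G -> R[i]) :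
  is_character h -> cmeasurable (h : borel G -> R[i]).
Proof.
move=> [hc _ _]; split; apply: continuous_borel => x.
  exact: (@continuous_comp G R[i]^o R^o h _ x (hc x) (@continuous_Re R _)).
exact: (@continuous_comp G R[i]^o R^o h _ x (hc x) (@continuous_Im R _)).
Qed.

Lemma measurable_translation (G : topologicalZmodType) (x : G) :
  measurable_fun [set: borel G] ((fun y : G => x + y) : borel G -> borel G).
Proof.
apply: (@measurability _ _ (borel G) (borel G) setT _
  (@open G : set (set (pointed_group G)))) => //.
move=> _ [A oA <-]; rewrite setTI; apply: sub_sigma_algebra.
suff : continuous (fun y : G => x + y) by move/continuousP; apply.
move=> y.
apply: (@continuous_comp G (G * G)%type G (fun y => (x, y)) (fun z => z.1 + z.2)).
  by apply: cvg_pair => /=; [exact: cvg_cst | exact: cvg_id].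
exact: tvs.add_continuous.
Qed.

Section haar.
Context (R : realType) (G : topologicalZmodType) (m : probability (borel G) R).
Context (hm : is_haar m).

Lemma haar_translation (x : G) (f : G -> R) :
  m.-integrable [set: borel G] (EFin \o (f : borel G -> R)) ->
  m.-integrable [set: borel G] (EFin \o ((fun y => f (x + y)) : borel G -> R)) /\
  Rintegral m [set: borel G] ((fun y => f (x + y)) : borel G -> R) =
  Rintegral m [set: borel G] f.
Proof.
move=> fi; pose phi : borel G -> borel G := fun y : G => x + y.
have mphi : measurable_fun [set: borel G] phi := measurable_translation x.
have [mf fl] := integrableP _ _ _ fi.
have inv (g : borel G -> \bar R) :
    (\int[pushforward m phi]_y g y = \int[m]_y g y)%E.
  apply: eq_measure_integral => A mA _.
  exact: hm.1.
have ci : m.-integrable [set: borel G] ((EFin \o (f : borel G -> R)) \o phi).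
  apply/integrableP; split; first exact: measurableT_comp.
  rewrite -(preimage_setT phi).
  rewrite -(ge0_integral_pushforward mphi m measurableT
    (f := abse \o (EFin \o (f : borel G -> R)))) //.
  - by rewrite inv.
  - exact: measurableT_comp.
  - by move=> y _; rewrite /= lee_fin.
split; first exact: ci.
rewrite /Rintegral; congr fine.
have := integral_pushforward mphi mf _ measurableT.
rewrite preimage_setT => /(_ m ci) <-.
by rewrite inv.
Qed.

Lemma haar_ctranslation (x : G) (f : G -> R[i]) :
  cintegrable m (f : borel G -> R[i]) ->
  cintegral m ((fun y => f (x + y)) : borel G -> R[i]) =
  cintegral m (f : borel G -> R[i]).
Proof.
move=> [f1 f2]; apply: complex_ext.
  exact: (haar_translation x f1).2.
exact: (haar_translation x f2).2.
Qed.

Lemma character_cintegrable (h : G -> R[i]) : is_character h ->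
  cintegrable m (h : borel G -> R[i]).
Proof.
move=> hh; apply: (cintegrable_le (g := fun=> 1)).
- exact: character_cmeasurable.
- by move=> x; rewrite normc_character.
- exact: integrable_cst.
Qed.

(** Translation by [x] multiplies the integral by [h x] and yet preserves it. *)
Lemma character_integral0 (h : G -> R[i]) (x : G) : is_character h -> h x != 1 ->
  cintegral m (h : borel G -> R[i]) = 0.
Proof.
move=> hh hx; have hi := character_cintegrable hh.
have := haar_ctranslation x hi.
have -> : cintegral m ((fun y => h (x + y)) : borel G -> R[i]) =
    h x * cintegral m (h : borel G -> R[i]).
  rewrite -cintegralZ //; apply: eq_cintegral => y.
  by case: hh => _ _ ->.
rewrite -{2}[cintegral m h]mul1r => /eqP; rewrite -subr_eq0 -mulrBl mulf_eq0.
by rewrite subr_eq0 (negbTE hx) => /eqP.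
Qed.

Lemma character_orthonormal (h k : G -> R[i]) : is_character h -> is_character k ->
  cintegral m ((fun x => h x * (k x)^*) : borel G -> R[i]) = (`[< h = k >])%:R.
Proof.
move=> hh hk; case: asboolP => [<-|hnk].
  rewrite (_ : cintegral m _ = cintegral m ((fun=> 1) : borel G -> R[i])).
    by apply: complex_ext; rewrite /cintegral /= Rintegral_prob_cst.
  by apply: eq_cintegral => x; rewrite mulcJ_normc normc_character // expr1n.
have [x hx] : exists x, h x != k x.
  apply: contrapT => hx; apply: hnk; apply/funext => x; apply: contrapT => hxk.
  by apply: hx; exists x; apply/eqP.
apply: (@character_integral0 _ x).
  by apply: characterM => //; exact: character_conj.
apply: contra hx => /eqP hx; apply/eqP.
have kk : (k x)^* * k x = 1 by rewrite mulrC mulcJ_normc normc_character // expr1n.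
by rewrite -[LHS]mulr1 -kk mulrA hx mul1r.
Qed.

End haar.

(** The linear span of the characters, as a predicate on functions. Scaling and addition are fused
    into one constructor so that inductions have a single linear case; the zero polynomial is
    obtained as [-1 * 1 + 1]. *)
Inductive trig_poly (R : realType) (G : topologicalZmodType) :
    (G -> R[i]) -> Prop :=
| trig_char (h : G -> R[i]) of is_character h : trig_poly h
| trig_lin (c : R[i]) (u v : G -> R[i]) of trig_poly u & trig_poly v :
    trig_poly (fun x => c * u x + v x).

Section trig_poly.
Context (R : realType) (G : topologicalZmodType).
Implicit Types u v : G -> R[i].

Lemma character1 : is_character ((fun=> 1) : G -> R[i]).
Proof.
split=> [x|x|x y]; first exact: cvg_cst.
  by rewrite normr1.
by rewrite mulr1.
Qed.

Lemma trig_ext u v : trig_poly u -> u =1 v -> trig_poly v.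
Proof. by move=> h /funext <-. Qed.

Lemma trig0 : trig_poly ((fun=> 0) : G -> R[i]).
Proof.
have h1 := trig_char character1.
by apply: trig_ext (trig_lin (-1) h1 h1) _ => x; rewrite mulr1 addNr.
Qed.

Lemma trigD u v : trig_poly u -> trig_poly v -> trig_poly (fun x => u x + v x).
Proof. by move=> hu hv; apply: trig_ext (trig_lin 1 hu hv) _ => x; rewrite mul1r. Qed.

Lemma trigZ c u : trig_poly u -> trig_poly (fun x => c * u x).
Proof. by move=> hu; apply: trig_ext (trig_lin c hu trig0) _ => x; rewrite addr0. Qed.

Lemma trig_sum (I : Type) (s : seq I) (F : I -> G -> R[i]) :
  (forall i, trig_poly (F i)) -> trig_poly (fun x => \sum_(i <- s) F i x).
Proof.
move=> hF; elim: s => [|i s IH].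
  by apply: trig_ext trig0 _ => x; rewrite big_nil.
by apply: trig_ext (trigD (hF i) IH) _ => x; rewrite big_cons.
Qed.

Lemma trig_conj u : trig_poly u -> trig_poly (fun x => (u x)^*).
Proof.
elim=> [h hh|c {}u v _ hu _ hv]; first exact/trig_char/character_conj.
by apply: trig_ext (trig_lin c^* hu hv) _ => x; rewrite rmorphD rmorphM.
Qed.

Lemma trigM u v : trig_poly u -> trig_poly v -> trig_poly (fun x => u x * v x).
Proof.
move=> hu hv; elim: hu => [h hh|c {}u w _ hu _ hw].
  elim: hv => [k hk|c {}v w _ hv _ hw]; first exact/trig_char/characterM.
  by apply: trig_ext (trig_lin c hv hw) _ => x; rewrite mulrDr mulrCA.
by apply: trig_ext (trig_lin c hu hw) _ => x; rewrite mulrDl mulrA.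
Qed.

Lemma trigX u n : trig_poly u -> trig_poly (fun x => u x ^+ n).
Proof.
move=> hu; elim: n => [|n IH]; first exact: trig_char character1.
by apply: trig_ext (trigM hu IH) _ => x; rewrite exprS.
Qed.

(** Since [|u|^2 = u * conj u], this follows from stability of the span under conjugation and
    products. It is what makes the weighted test function a trigonometric polynomial. *)
Lemma trig_horner_real (r : {poly R}) u : trig_poly u ->
  trig_poly (fun x => (r.[normc (u x) ^+ 2])%:C).
Proof.
move=> hu; have huu := trigM hu (trig_conj hu).
have := @trig_sum _ (index_enum 'I_(size r))
  (fun i x => (r`_i)%:C * (u x * (u x)^*) ^+ i) (fun i => trigZ _ (trigX i huu)).
move/trig_ext; apply=> x; rewrite horner_coef rmorph_sum.
by apply: eq_bigr => i _; rewrite mulcJ_normc [RHS]rmorphM; congr (_ * _); rewrite [RHS]rmorphXn.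
Qed.

Lemma trig_translation (y : G) u : trig_poly u -> trig_poly (fun x => u (y + x)).
Proof.
elim=> [h hh|c {}u v _ hu _ hv]; last exact: trig_lin.
apply: trig_ext (trigZ (h y) (trig_char hh)) _ => x.
by case: hh => _ _ ->.
Qed.

Lemma trig_cmeasurable u : trig_poly u -> cmeasurable (u : borel G -> R[i]).
Proof.
elim=> [h hh|c {}u v _ hu _ hv]; first exact: character_cmeasurable.
by apply: cmeasurableD => //; apply: cmeasurableM => //; exact: cmeasurable_cst.
Qed.

Lemma trig_bounded u : trig_poly u -> exists2 K, 0 < K & forall x, normc (u x) <= K.
Proof.
elim=> [h hh|c {}u v _ [K K0 hu] _ [L L0 hv]].
  by exists 1 => // x; rewrite normc_character.
exists (normc c * K + L) => [|x].
  by rewrite ltr_wpDl // mulr_ge0 ?normc_ge0 // ltW.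
apply: le_trans (le_normcD _ _) _; rewrite normcM lerD //.
by rewrite ler_wpM2l // normc_ge0.
Qed.

Lemma trig_cintegrableM (m : probability (borel G) R) (f u : G -> R[i]) :
  cintegrable m (f : borel G -> R[i]) -> trig_poly u ->
  cintegrable m ((fun x => f x * u x) : borel G -> R[i]).
Proof.
move=> hf hu; have [K K0 uK] := trig_bounded hu.
apply: (@cintegrable_le _ (borel G) R m _ (fun x => K * normc (f x))).
- apply: cmeasurableM; first exact: cintegrable_measurable hf.
  exact: trig_cmeasurable.
- by move=> x; rewrite normcM mulrC ler_wpM2r // normc_ge0.
- exact: integrableZ_EFin (integrable_normc hf).
Qed.

Lemma trig_cintegrable (m : probability (borel G) R) u :
  trig_poly u -> cintegrable m (u : borel G -> R[i]).
Proof.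
move=> hu; have [K K0 uK] := trig_bounded hu.
apply: (@cintegrable_le _ (borel G) R m _ (fun=> K)) => //; first exact: trig_cmeasurable.
exact: integrable_cst.
Qed.

End trig_poly.

(** * Dirichlet groups *)

(* In argument position of a ring operation [^*] is [Num.conj], elsewhere [conjc]. *)
Lemma conj_conjc (R : rcfType) (z : R[i]) : Num.conj (conjc z) = z.
Proof. exact: conjcK. Qed.

Section dirichlet_group.
Context (R : realType) (lam : nat -> R) (G : topologicalZmodType)
  (m : probability (borel G) R) (beta : R -> G).
Context (hlam : is_frequency lam) (hG : is_dirichlet_group lam m beta).

(** Both characters are continuous and agree on the dense range of [beta]. *)
Lemma frequency_char_unique (x : R) (h k : G -> R[i]) :
  is_char_of_freq beta x h -> is_char_of_freq beta x k -> h = k.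
Proof.
move=> [hh hb] [hk kb]; apply/funext => z; apply/eqP; rewrite -subr_eq0; apply/eqP.
have [hc _ _] := hh; have [kc _ _] := hk.
have dc : continuous ((fun y => h y - k y) : G -> R[i]^o).
  by move=> y; apply: (@cvgB R[i] R[i]^o); [exact: hc | exact: kc].
apply: eq0_normc; apply/eqP; rewrite eq_le normc_ge0 andbT.
apply/ler_addgt0Pr => e e0; rewrite add0r.
have nz : nbhs z [set y | normc ((h z - k z) - (h y - k y)) < e].
  exact: (dc z _ (near_normc (h z - k z : R[i]^o) e0)).
have : (fun y => normc ((h z - k z) - (h y - k y)) < e) `&` range beta !=set0.
  move: nz; rewrite nbhsE => -[B [oB Bz] BA].
  have [|y [yB ry]] := dg_dense hG _ oB; first by exists z.
  by exists y; split => //; exact: BA.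
move=> [y [/= hy [t _ ty]]]; move: hy; rewrite -ty hb kb subrr subr0; exact: ltW.
Qed.

Lemma frequency_char_neq (j k : nat) (h h' : G -> R[i]) : j != k ->
  is_char_of_freq beta (lam j) h -> is_char_of_freq beta (lam k) h' -> h <> h'.
Proof.
move=> jk [_ hb] [_ hb'] E.
have [_ mono _] := hlam.
have d0 : lam j - lam k != 0.
  rewrite subr_eq0; move: jk; rewrite neq_ltn => /orP[] /mono; first by move/lt_eqF ->.
  by rewrite eq_sym => /lt_eqF ->.
(* At this time the two characters take opposite values on [beta t], so equality would force
   [1 = -1]. *)
pose t := pi / (lam j - lam k).
have := hb t; rewrite E hb' => -[ec /oppr_inj es].
have : cos (lam j * t - lam k * t) = -1.
  by rewrite -mulrBl /t mulrC divfK // cospi.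
rewrite cosB ec es -!expr2 cos2Dsin2 => /eqP.
by rewrite -subr_eq0 opprK (_ : 1 + 1 = 2%:R) // pnatr_eq0.
Qed.

Context (h : nat -> G -> R[i]) (hh : forall n, is_char_of_freq beta (lam n) (h n)).

Lemma dirichlet_poly_trig (b : nat -> R[i]) N :
  trig_poly (fun x => \sum_(n < N) b n * h n x).
Proof. by apply: trig_sum => n; exact/trigZ/trig_char/(hh n).1. Qed.

Lemma fourier_dirichlet_poly (b : nat -> R[i]) N (k : G -> R[i]) :
  is_character k ->
  fourier m (fun x => \sum_(n < N) b n * h n x) k =
  \sum_(n < N) b n * (`[< h n = k >])%:R.
Proof.
move=> hk.
have hc (n : nat) : cintegrable m ((fun x => h n x * (k x)^*) : borel G -> R[i]).
  apply: trig_cintegrable; apply: trig_char; apply: characterM; first exact: (hh n).1.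
  exact: character_conj.
transitivity (cintegral m ((fun x => \sum_(n < N) b n * (h n x * (k x)^*))
    : borel G -> R[i])).
  by apply: eq_cintegral => x; rewrite mulr_suml; apply: eq_bigr => n _; rewrite mulrA.
rewrite (@cintegral_sum _ (borel G) _ _ _ _ (fun (n : 'I_N) x => b n * (h n x * (k x)^*))).
  by apply: eq_bigr => n _; rewrite cintegralZ // (character_orthonormal (dg_haar hG) (hh n).1 hk).
by move=> n; exact: cintegrableZ.
Qed.

Lemma fourier_dirichlet_poly_coef (b : nat -> R[i]) N k :
  fourier m (fun x => \sum_(n < N) b n * h n x) (h k) =
  if (k < N)%N then b k else 0.
Proof.
rewrite (fourier_dirichlet_poly _ _ (hh k).1); case: ltnP => kN.
  rewrite (bigD1 (Ordinal kN)) //= asboolT // mulr1 big1 ?addr0 // => n nk.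
  rewrite asboolF ?mulr0 //; exact: (frequency_char_neq (nk : (n : nat) != k) (hh n) (hh k)).
rewrite big1 // => n _; rewrite asboolF ?mulr0 //.
have nk : (n : nat) != k by rewrite neq_ltn (leq_trans (ltn_ord n) kN).
exact: frequency_char_neq nk (hh n) (hh k).
Qed.

Lemma fourier_dirichlet_poly0 (b : nat -> R[i]) N (k : G -> R[i]) : is_character k ->
  (forall n, ~ is_char_of_freq beta (lam n) k) ->
  fourier m (fun x => \sum_(n < N) b n * h n x) k = 0.
Proof.
move=> hk nk; rewrite fourier_dirichlet_poly // big1 // => n _.
by rewrite asboolF ?mulr0 // => E; apply: (nk n); rewrite -E.
Qed.

Lemma dirichlet_poly_parseval (b : nat -> R[i]) N :
  Rintegral m [set: borel G] ((fun x => normc (\sum_(n < N) b n * h n x) ^+ 2)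
     : borel G -> R) = \sum_(n < N) normc (b n) ^+ 2.
Proof.
set Q := fun x => \sum_(n < N) b n * h n x.
have hQ : trig_poly Q := dirichlet_poly_trig b N.
have E : cintegral m ((fun x => Q x * (Q x)^*) : borel G -> R[i]) =
    \sum_(n < N) (b n)^* * b n.
  transitivity (cintegral m ((fun x => \sum_(n < N) (b n)^* * (Q x * (h n x)^*))
    : borel G -> R[i])).
    apply: eq_cintegral => x; rewrite {2}/Q rmorph_sum mulr_sumr.
    by apply: eq_bigr => n _; rewrite rmorphM mulrCA.
  have ci (n : 'I_N) : cintegrable m ((fun x => Q x * (h n x)^*) : borel G -> R[i]).
    apply: trig_cintegrable; apply: trigM => //.
    exact/trig_conj/trig_char/(hh n).1.
  rewrite (@cintegral_sum _ (borel G) _ _ _ _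
    (fun (n : 'I_N) x => (b n)^* * (Q x * (h n x)^*))).
    apply: eq_bigr => n _; rewrite cintegralZ //.
    by rewrite -/(fourier m Q (h n)) fourier_dirichlet_poly_coef ltn_ord.
  by move=> n; exact: cintegrableZ.
have := congr1 (@complex.Re R) E; rewrite /cintegral /=.
under eq_Rintegral do rewrite mulcJ_normc /=.
move=> ->; rewrite (_ : \sum_(n < N) _ = (\sum_(n < N) normc (b n) ^+ 2)%:C) //.
by rewrite rmorph_sum; apply: eq_bigr => n _; rewrite mulrC mulcJ_normc.
Qed.

(** The measure [s] is carried to G along [beta] and acts on the test function. By invariance,
    pairing f with [g (beta t + y)] amounts to pairing [f (y - beta t)] with g; this multiplies the
    coefficient at [lam n] by [cis (lam n * t)], in agreement with the sign in [atomic_symbol]. *)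
Definition atomic_translate (s : seq (R[i] * R)) (g : G -> R[i]) (y : G) : R[i] :=
  \sum_(i <- s) i.1 * g (beta i.2 + y).

Lemma atomic_translate_trig s g : trig_poly g -> trig_poly (atomic_translate s g).
Proof. by move=> hg; apply: trig_sum => i; exact/trigZ/trig_translation. Qed.

(* Only the spectrum of f in the spectrum of g matters, so the Fourier transform
   of the atomic measure s need approximate phi at finitely many lam n only. *)
Lemma atomic_translate_approx (f : G -> R[i]) (a : nat -> R[i]) (phi : R -> R) N
    (g : G -> R[i]) (e : R) :
  cintegrable m (f : borel G -> R[i]) ->
  (forall n, a n = fourier m f (h n)) ->
  (forall k, is_character k -> fourier m f k != 0 ->
     exists n, is_char_of_freq beta (lam n) k) ->
  (forall n, (N <= n)%N -> phi (lam n) = 0) ->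
  trig_poly g -> 0 < e ->
  exists (X : seq R) (d : R), 0 < d /\ forall s : seq (R[i] * R),
    {in X, forall x, normc (atomic_symbol s x - (phi x)%:C) <= d} ->
    normc (cintegral m ((fun y => f y * atomic_translate s g y) : borel G -> R[i]) -
      cintegral m ((fun y => (\sum_(n < N) ((phi (lam n))%:C * a n) * h n y) * g y)
        : borel G -> R[i])) <= e.
Proof.
move=> fi ha hspec hphi hg.
set Q := fun y => \sum_(n < N) ((phi (lam n))%:C * a n) * h n y.
have hQ : trig_poly Q := dirichlet_poly_trig (fun n => (phi (lam n))%:C * a n) N.
elim: hg e => [chi hchi|c u v hu IHu hv IHv] e e0; last first.
  have c0 : 0 < normc c + 1 by rewrite ltr_wpDl ?normc_ge0.
  have e20 : 0 < e / 2 by rewrite divr_gt0.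
  have [X [d [d0 hX]]] := IHu (e / 2 / (normc c + 1)) (divr_gt0 e20 c0).
  have [Y [d' [d'0 hY]]] := IHv (e / 2) e20.
  exists (X ++ Y), (Num.min d d'); split; first by rewrite lt_min d0.
  move=> s hs.
  have hsX : {in X, forall x, normc (atomic_symbol s x - (phi x)%:C) <= d}.
    move=> x xX; apply: le_trans (hs x _) _; first by rewrite mem_cat xX.
    by rewrite ge_min lexx.
  have hsY : {in Y, forall x, normc (atomic_symbol s x - (phi x)%:C) <= d'}.
    move=> x xX; apply: le_trans (hs x _) _; first by rewrite mem_cat xX orbT.
    by rewrite ge_min lexx orbT.
  have {}hX := hX s hsX; have {}hY := hY s hsY.
  have fT w : trig_poly w ->
      cintegrable m ((fun y => f y * atomic_translate s w y) : borel G -> R[i]).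
    by move=> hw; apply: trig_cintegrableM => //; exact: atomic_translate_trig.
  have QT w : trig_poly w -> cintegrable m ((fun y => Q y * w y) : borel G -> R[i]).
    by move=> hw; apply: trig_cintegrable; exact: trigM.
  rewrite (_ : cintegral m _ =
      c * cintegral m ((fun y => f y * atomic_translate s u y) : borel G -> R[i]) +
      cintegral m ((fun y => f y * atomic_translate s v y) : borel G -> R[i])); last first.
    rewrite -(cintegralZ c (fT u hu)).
    rewrite -(cintegralD (cintegrableZ c (fT u hu)) (fT v hv)).
    apply: eq_cintegral => y; rewrite /atomic_translate !mulr_sumr -big_split /=.
    by apply: eq_bigr => i _; ring.
  rewrite (_ : cintegral m (fun y => Q y * (c * u y + v y)) =
      c * cintegral m ((fun y => Q y * u y) : borel G -> R[i]) +
      cintegral m ((fun y => Q y * v y) : borel G -> R[i])); last first.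
    rewrite -(cintegralZ c (QT u hu)).
    rewrite -(cintegralD (cintegrableZ c (QT u hu)) (QT v hv)).
    by apply: eq_cintegral => y; ring.
  rewrite opprD addrACA -mulrBr; apply: le_trans (le_normcD _ _) _.
  rewrite [e](splitr e) lerD // normcM.
  apply: le_trans (ler_wpM2l (normc_ge0 _) hX) _.
  by rewrite mulrA ler_pdivrMr // mulrC ler_wpM2l ?(ltW e20) // lerDl.
(* Base case: pairing with a character is taking a Fourier coefficient at its conjugate, and a
   translation only contributes the value of the character at [beta t]. *)
have hk := character_conj hchi.
have Qk : cintegral m ((fun y => Q y * chi y) : borel G -> R[i]) =
    fourier m Q (fun y => (chi y)^*).
  by apply: eq_cintegral => y; rewrite conj_conjc.
have fk : cintegral m ((fun y => f y * chi y) : borel G -> R[i]) =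
    fourier m f (fun y => (chi y)^*).
  by apply: eq_cintegral => y; rewrite conj_conjc.
have fTk s : cintegral m ((fun y => f y * atomic_translate s chi y) : borel G -> R[i])
    = (\sum_(i <- s) i.1 * chi (beta i.2)) *
      cintegral m ((fun y => f y * chi y) : borel G -> R[i]).
  rewrite -cintegralZ; last exact: trig_cintegrableM (trig_char hchi).
  apply: eq_cintegral => y; rewrite /atomic_translate mulr_sumr mulr_suml.
  by apply: eq_bigr => i _; have [_ _ ->] := hchi; ring.
have [[n hn]|nk] := pselect (exists n, is_char_of_freq beta (lam n) (fun y => (chi y)^*)).
  have E := frequency_char_unique hn (hh n).
  have a0 : 0 < normc (a n) + 1 by rewrite ltr_wpDl ?normc_ge0.
  exists [:: lam n], (e / (normc (a n) + 1)); split; first exact: divr_gt0.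
  move=> s /(_ (lam n)); rewrite mem_head => /(_ isT) hs.
  have -> : cintegral m ((fun y => f y * atomic_translate s chi y) : borel G -> R[i]) =
      atomic_symbol s (lam n) * a n.
    rewrite fTk fk E -ha; congr (_ * _); apply: eq_bigr => i _; congr (_ * _).
    (* The conjugate of [chi] takes the value e^(-i lam_n t) at [beta t], so [chi] itself gives
       [cis (lam n * t)]. *)
    rewrite -[LHS]conjcK; have [_ ->] := hn.
    by rewrite /cis /= opprK.
  rewrite Qk E /Q (fourier_dirichlet_poly_coef (fun n => (phi (lam n))%:C * a n)).
  have -> : (if (n < N)%N then (phi (lam n))%:C * a n else 0) = (phi (lam n))%:C * a n.
    by case: ltnP => // /hphi ->; rewrite mul0r.
  rewrite -mulrBl normcM mulrC.
  apply: le_trans (ler_wpM2l (normc_ge0 _) hs) _.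
  by rewrite mulrA ler_pdivrMr // mulrC ler_wpM2l ?(ltW e0) // lerDl.
(* Off the frequencies both integrals vanish: the first by the spectral hypothesis on [f], the
   second by orthogonality of characters. *)
exists [::], 1; split => // s _.
have f0 : fourier m f (fun y => (chi y)^*) = 0.
  apply: contrapT => /eqP; rewrite -/(_ != 0) => /(hspec _ hk) [n hn].
  by apply: nk; exists n.
rewrite fTk fk f0 mulr0 Qk /Q.
rewrite (fourier_dirichlet_poly0 (fun n => (phi (lam n))%:C * a n)) //; last first.
  by move=> n hn; apply: nk; exists n.
by rewrite subrr normc0 ltW.
Qed.

End dirichlet_group.

(** * Norm estimates *)

Lemma ReN (R : rcfType) (x : R[i]) : complex.Re (- x) = - complex.Re x.
Proof. by case: x. Qed.

(** Young's inequality for [C * u] and [w ^ ((p - 1) / 2)] with exponents p and p / (p - 1), divided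
    by [C]. Once summed over a measure of mass [C], the second term has coefficient [1 - 1 / p < 1]
    and can be absorbed. The case p = 1, with infinite conjugate exponent, is separate. *)
Lemma young_scaled (R : realType) (u w C p : R) :
  0 <= u -> 0 < w -> 0 < C -> 1 <= p ->
  u * w `^ ((p - 1) / 2) <= C `^ (p - 1) / p * u `^ p + (1 - p^-1) / C * w `^ (p / 2).
Proof.
move=> u0 w0 C0; rewrite le_eqVlt => /predU1P[<-|p1].
  rewrite subrr mul0r !powRr0 mulr1 invr1 subrr !mul0r addr0 mulr1 mul1r.
  by rewrite powRr1.
have p0 : 0 < p by exact: lt_trans ltr01 p1.
have p10 : 0 < p - 1 by rewrite subr_gt0.
have b0 : 0 <= w `^ ((p - 1) / 2) := powR_ge0 _ _.
have q0 : 0 < p / (p - 1) by rewrite divr_gt0.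
have pq : p^-1 + (p / (p - 1))^-1 = 1 by field; rewrite !gt_eqF.
have := conjugate_powR (mulr_ge0 (ltW C0) u0) b0 p0 q0 pq.
rewrite powRM ?(ltW C0) // -powRrM.
have -> : (p - 1) / 2 * (p / (p - 1)) = p / 2 by field; rewrite gt_eqF.
have -> : C `^ p = C * C `^ (p - 1) by rewrite mulr_powRB1 // ltW.
move=> hY; rewrite -(ler_pM2l C0).
rewrite mulrA; apply: le_trans hY _.
rewrite le_eqVlt; apply/orP; left; apply/eqP; field; rewrite !gt_eqF //.
Qed.

(** Here [s] stands for |Q|^2 and [r] for the polynomial weight, so the two claims bound |g| from
    above and [Q * g] from below for [g = conj Q * r]. The loss [d ^ (p / 2)] is the bound for
    [d * (s + d) ^ (p / 2 - 1)], where p <= 2 makes the exponent non-positive; [eta * M] is the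
    approximation error. *)
Lemma test_weight (R : realType) (s d r p eta M : R) :
  0 <= s <= M -> 0 < d -> 1 <= p <= 2 -> 0 < eta ->
  0 <= r <= (s + d) `^ (- (1 - p / 2)) -> (s + d) `^ (- (1 - p / 2)) <= r + eta ->
  Num.sqrt s * r <= (s + d) `^ ((p - 1) / 2) /\
  (s + d) `^ (p / 2) - d `^ (p / 2) - eta * M <= s * r.
Proof.
move=> /andP[s0 sM] d0 /andP[p1 p2] eta0 /andP[r0 r1] r2.
have w0 : 0 < s + d by rewrite ltr_wpDl.
have p0 : 0 < p by exact: lt_le_trans ltr01 p1.
have a0 : 0 <= 1 - p / 2 by lra.
split.
  have -> : (p - 1) / 2 = 2^-1 + - (1 - p / 2) by field.
  rewrite powRD; last by rewrite (gt_eqF w0) implybT.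
  apply: ler_pM => //.
  rewrite powR12_sqrt; last exact: ltW.
  by apply: ler_wsqrtr; rewrite lerDl ltW.
have E (x : R) : 0 < x -> x `^ (p / 2) = x * x `^ (- (1 - p / 2)).
  move=> x0; rewrite -[in RHS](powRr1 (ltW x0)) -powRrM -powRD.
    by congr powR; ring.
  by rewrite (gt_eqF x0) implybT.
rewrite !E //.
have h1 : (s + d) `^ (- (1 - p / 2)) <= d `^ (- (1 - p / 2)).
  rewrite !powRN lef_pV2 ?posrE ?powR_gt0 //.
  by rewrite ge0_ler_powR ?nnegrE ?(ltW d0) ?(ltW w0) // lerDr.
set W := _ `^ _ in r1 r2 h1 *; set D := d `^ _ in h1 *.
have h2 : d * W <= d * D by rewrite ler_pM2l.
have h3 : s * W <= s * (r + eta) by rewrite ler_wpM2l.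
have h4 : eta * s <= eta * M by rewrite ler_pM2l.
lra.
Qed.

Lemma cauchy_schwarz_card (R : realType) (N : nat) (x : nat -> R) :
  (\sum_(n < N) x n) ^+ 2 <= N%:R * \sum_(n < N) x n ^+ 2.
Proof.
have -> : N%:R * \sum_(n < N) x n ^+ 2 =
    \sum_(i < N) \sum_(j < N) (x i ^+ 2 + x j ^+ 2) / 2.
  have -> : \sum_(i < N) \sum_(j < N) (x i ^+ 2 + x j ^+ 2) / 2 =
      \sum_(i < N) (N%:R * x i ^+ 2 / 2 + (\sum_(j < N) x j ^+ 2) / 2).
    apply: eq_bigr => i _; rewrite -mulr_suml big_split /= sumr_const card_ord.
    by rewrite mulrDl mulr_natl.
  rewrite big_split /= sumr_const card_ord -mulr_suml -mulr_sumr -mulr_natl.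
  by field.
rewrite expr2 big_distrlr /=; apply: ler_sum => i _; apply: ler_sum => j _.
by have := sqr_ge0 (x i - x j); nra.
Qed.

Section lp_bounds.
Context (R : realType) (lam : nat -> R) (G : topologicalZmodType)
  (m : probability (borel G) R) (beta : R -> G).
Context (hlam : is_frequency lam) (hG : is_dirichlet_group lam m beta).
Context (h : nat -> G -> R[i]) (hh : forall n, is_char_of_freq beta (lam n) (h n)).

Lemma trig_integrable_powR (u : G -> R[i]) (q d : R) : 0 <= q -> 0 <= d ->
  trig_poly u ->
  m.-integrable [set: borel G] (EFin \o ((fun x => (normc (u x) ^+ 2 + d) `^ q)
    : borel G -> R)).
Proof.
move=> q0 d0 hu; have [K K0 hK] := trig_bounded hu.
apply: (@integrable_le _ (borel G) R m _ (fun=> (K ^+ 2 + d) `^ q)).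
- apply: (measurableT_comp (measurable_powR _)).
  apply: measurable_funD => //; apply: measurable_funX.
  exact/measurable_normc/trig_cmeasurable.
- move=> x; rewrite ger0_norm ?powR_ge0 // ge0_ler_powR ?nnegrE ?addr_ge0 ?sqr_ge0 //.
  by rewrite lerD2r ler_pXn2r ?nnegrE ?normc_ge0 // ltW.
- exact: integrable_cst.
Qed.

Lemma trig_integrable_normc_powR (u : G -> R[i]) (q : R) : 0 <= q ->
  trig_poly u ->
  m.-integrable [set: borel G] (EFin \o ((fun x => normc (u x) `^ q)
    : borel G -> R)).
Proof.
move=> q0 hu.
have q20 : 0 <= q / 2 by rewrite divr_ge0.
have := trig_integrable_powR q20 (lexx 0) hu.
rewrite (_ : (fun x => _) = (fun x => normc (u x) `^ q)) //; apply/funext => x.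
by rewrite addr0 -powR_mulrn ?normc_ge0 // -powRrM; congr powR; field.
Qed.

(* By duality: test Q against a trigonometric polynomial g close to
   conj Q (|Q|^2 + d)^((p - 2) / 2). Translations act on g instead of f, and Young's
   inequality bounds the result. Working with polynomials g avoids any uniqueness
   theorem for Fourier coefficients on G. *)
Lemma multiplier_Lp_delta (f : G -> R[i]) (a : nat -> R[i]) (phi : R -> R) N
    (p C d : R) :
  1 <= p <= 2 -> 0 < C -> 0 < d -> is_multiplier phi C ->
  in_Lp m p%:E (f : borel G -> R[i]) ->
  (forall n, a n = fourier m f (h n)) ->
  (forall k, is_character k -> fourier m f k != 0 ->
     exists n, is_char_of_freq beta (lam n) k) ->
  (forall n, (N <= n)%N -> phi (lam n) = 0) ->
  Rintegral m [set: borel G] ((fun x =>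
      normc (\sum_(n < N) ((phi (lam n))%:C * a n) * h n x) `^ p) : borel G -> R) <=
  C `^ p * Rintegral m [set: borel G] ((fun x => normc (f x) `^ p) : borel G -> R)
    + p * d `^ (p / 2).
Proof.
move=> p12 C0 d0 hphi fp ha hspec hN; have /andP[p1 p2] := p12.
have p0 : 0 < p by exact: lt_le_trans ltr01 p1.
have fi := in_Lp_cintegrable p1 fp.
have [_ fpi] := (in_Lp_integrable m f p0).1 fp.
set Q := fun y => \sum_(n < N) ((phi (lam n))%:C * a n) * h n y.
have hQ : trig_poly Q :=
  dirichlet_poly_trig hh (fun n => (phi (lam n))%:C * a n) N.
have [S S0 QS] := trig_bounded hQ.
(* Adding [d] keeps the weight [w ^ ((p - 2) / 2)] bounded at the zeros of [Q], where the exponent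
   is negative if p < 2; [d] is made small afterwards. *)
pose w x := normc (Q x) ^+ 2 + d.
have w0 x : 0 < w x by rewrite /w ltr_wpDl ?sqr_ge0.
set If := Rintegral m _ ((fun x => normc (f x) `^ p) : borel G -> R).
pose wp x := w x `^ (p / 2).
have wpi : m.-integrable [set: borel G] (EFin \o (wp : borel G -> R)).
  by apply: trig_integrable_powR => //; [rewrite divr_ge0 // ltW | exact: ltW].
pose IB := Rintegral m [set: borel G] (wp : borel G -> R).
have key eta e : 0 < eta -> 0 < e ->
    IB - d `^ (p / 2) - eta * S ^+ 2 <= C `^ p / p * If + (1 - p^-1) * IB + e.
  move=> eta0 e0.
  have a01 : 0 <= 1 - p / 2 <= 1 by apply/andP; split; lra.
  have [r hr] := powR_poly_approx_below d0 a01 (exprn_gt0 2 S0) eta0.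
  pose rQ x := r.[normc (Q x) ^+ 2].
  pose g x := (Q x)^* * (rQ x)%:C.
  have hg : trig_poly g by apply: trigM; [exact: trig_conj | exact: trig_horner_real].
  have tw x : Num.sqrt (normc (Q x) ^+ 2) * rQ x <= w x `^ ((p - 1) / 2) /\
      wp x - d `^ (p / 2) - eta * S ^+ 2 <= normc (Q x) ^+ 2 * rQ x.
    have hs : 0 <= normc (Q x) ^+ 2 <= S ^+ 2.
      by rewrite sqr_ge0 ler_pXn2r ?nnegrE ?normc_ge0 ?(ltW S0) //= QS.
    have [r1 r2] := hr _ hs.
    exact: test_weight hs d0 p12 eta0 r1 r2.
  have rQ0 x : 0 <= rQ x.
    have hs : 0 <= normc (Q x) ^+ 2 <= S ^+ 2.
      by rewrite sqr_ge0 ler_pXn2r ?nnegrE ?normc_ge0 ?(ltW S0) //= QS.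
    by have [/andP[]] := hr _ hs.
  have gw x : normc (g x) <= w x `^ ((p - 1) / 2).
    rewrite /g normcM normc_conj normc_real (ger0_norm (rQ0 x)).
    by have [] := tw x; rewrite sqrtr_sqr (ger0_norm (normc_ge0 _)).
  have [X [dl [dl0 happ]]] := atomic_translate_approx hlam hG hh fi ha hspec hN hg e0.
  have [s [sC hs]] := hphi X dl dl0.
  have {}happ := happ s hs.
  have QgE x : Q x * g x = (normc (Q x) ^+ 2 * rQ x)%:C.
    by rewrite /g mulrA mulcJ_normc [RHS]rmorphM.
  have lower : IB - d `^ (p / 2) - eta * S ^+ 2 <=
      complex.Re (cintegral m ((fun y => Q y * g y) : borel G -> R[i])).
    have Qgi : cintegrable m ((fun y => Q y * g y) : borel G -> R[i]).
      by apply: trig_cintegrable; exact: trigM.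
    apply: (@le_trans _ _ (Rintegral m [set: borel G]
      ((fun x => wp x + (- d `^ (p / 2) - eta * S ^+ 2)) : borel G -> R))).
      rewrite RintegralD //; last exact: integrable_cst.
      by rewrite Rintegral_prob_cst addrA.
    apply: le_Rintegral => //.
    - by apply: integrableD_EFin => //; exact: integrable_cst.
    - by case: Qgi.
    - by move=> x _; rewrite QgE /= addrA; case: (tw x).
  have upper : complex.Re (cintegral m
       ((fun y => f y * atomic_translate beta s g y) : borel G -> R[i])) <=
      C `^ p / p * If + (1 - p^-1) * IB.
    pose K := C `^ (p - 1) / p * If + (1 - p^-1) / C * IB.
    have one (i : R[i] * R) : complex.Re (cintegral m
        ((fun y => i.1 * (f y * g (beta i.2 + y))) : borel G -> R[i])) <=
        normc i.1 * K.
      (* Only [g] is translated, and invariance returns the same integral [IB] for every atom; the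
         atoms then contribute through their total mass alone. *)
      have [ti tE] := haar_translation (dg_haar hG) (beta i.2) wpi.
      pose B1 y := C `^ (p - 1) / p * normc (f y) `^ p.
      pose B2 y := (1 - p^-1) / C * wp (beta i.2 + y).
      have B1i : m.-integrable [set: borel G] (EFin \o (B1 : borel G -> R)).
        exact: integrableZ_EFin.
      have B2i : m.-integrable [set: borel G] (EFin \o (B2 : borel G -> R)).
        exact: integrableZ_EFin.
      pose B y := B1 y + B2 y.
      have Bi : m.-integrable [set: borel G] (EFin \o (B : borel G -> R)).
        exact: integrableD_EFin.
      have BK : Rintegral m [set: borel G] (B : borel G -> R) = K.
        have -> := RintegralD measurableT B1i B2i.
        have -> := RintegralZl (C `^ (p - 1) / p) measurableT fpi.
        have -> := RintegralZl ((1 - p^-1) / C) measurableT ti.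
        by rewrite tE.
      have fgi : cintegrable m
          ((fun y => i.1 * (f y * g (beta i.2 + y))) : borel G -> R[i]).
        apply: (@cintegrableZ _ (borel G)).
        exact: trig_cintegrableM fi (trig_translation _ hg).
      have fgB y : normc (i.1 * (f y * g (beta i.2 + y))) <= normc i.1 * B y.
        rewrite normcM; apply: ler_wpM2l; first exact: normc_ge0.
        rewrite normcM; apply: le_trans (ler_wpM2l (normc_ge0 _) (gw _)) _.
        exact: young_scaled (normc_ge0 _) (w0 _) C0 p1.
      have := Re_cintegral_le fgi (integrableZ_EFin (normc i.1) Bi) fgB.
      have -> := RintegralZl (normc i.1) measurableT Bi.
      by rewrite BK.
    have -> : cintegral m ((fun y => f y * atomic_translate beta s g y)
        : borel G -> R[i]) = \sum_(i <- s) cintegral m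
          ((fun y => i.1 * (f y * g (beta i.2 + y))) : borel G -> R[i]).
      rewrite -cintegral_sum; last first.
        move=> i; apply: cintegrableZ; apply: trig_cintegrableM => //.
        exact: trig_translation.
      apply: eq_cintegral => y; rewrite mulr_sumr; apply: eq_bigr => i _.
      by rewrite mulrCA.
    have Re_sum (F : R[i] * R -> R[i]) : complex.Re (\sum_(i <- s) F i) =
        \sum_(i <- s) complex.Re (F i).
      by elim: (s) => [|i t IH]; rewrite ?big_nil // !big_cons ReD IH.
    rewrite Re_sum; apply: le_trans (ler_sum _ (fun i _ => one i)) _.
    rewrite -mulr_suml.
    have If0 : 0 <= If by apply: Rintegral_ge0 => x _; exact: powR_ge0.
    have IB0 : 0 <= IB by apply: Rintegral_ge0 => x _; exact: powR_ge0.
    have ip1 : 0 <= 1 - p^-1 by rewrite subr_ge0 invf_le1.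
    have K0 : 0 <= K.
      apply: addr_ge0; apply: mulr_ge0 => //; apply: divr_ge0 => //.
      - exact: powR_ge0.
      - exact: ltW.
      - exact: ltW.
    apply: le_trans (ler_wpM2r K0 sC) _.
    rewrite -[C `^ p]mulr_powRB1 ?(ltW C0) // /K le_eqVlt; apply/orP; left; apply/eqP.
    by field; rewrite !gt_eqF.
  apply: le_trans lower _.
  rewrite -lerBlDl; apply: le_trans happ.
  rewrite normc_distC; apply: le_trans (ler_Re_normc _).
  by rewrite ReD ReN lerD2l lerN2.
have key2 : IB - d `^ (p / 2) <= C `^ p / p * If + (1 - p^-1) * IB.
  apply/ler_addgt0Pr => e e0.
  have e20 : 0 < e / 2 by rewrite divr_gt0.
  have S20 : 0 < S ^+ 2 by rewrite exprn_gt0.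
  have := key _ _ (divr_gt0 e20 S20) e20; rewrite divfK ?gt_eqF //; lra.
apply: (@le_trans _ _ IB).
  apply: le_Rintegral => //.
    by apply: trig_integrable_normc_powR => //; exact: ltW.
  move=> x _; rewrite /wp.
  have -> : normc (Q x) `^ p = (normc (Q x) ^+ 2) `^ (p / 2).
    by rewrite -powR_mulrn ?normc_ge0 // -powRrM; congr powR; field.
  rewrite ge0_ler_powR ?nnegrE ?sqr_ge0 ?(ltW (w0 _)) //; first by rewrite divr_ge0 // ltW.
  by rewrite /w lerDl ltW.
(* The term [(1 - p^-1) * IB] is absorbed on the left; clearing [IB / p] produces the factor [p] in
   front of the power of [d]. *)
have : IB / p <= C `^ p / p * If + d `^ (p / 2) by lra.
rewrite ler_pdivrMr // => /le_trans; apply.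
rewrite le_eqVlt; apply/orP; left; apply/eqP; field; rewrite gt_eqF //.
Qed.

Lemma multiplier_Lp (f : G -> R[i]) (a : nat -> R[i]) (phi : R -> R) N (p C : R) :
  1 <= p <= 2 -> 0 < C -> is_multiplier phi C ->
  in_Lp m p%:E (f : borel G -> R[i]) ->
  (forall n, a n = fourier m f (h n)) ->
  (forall k, is_character k -> fourier m f k != 0 ->
     exists n, is_char_of_freq beta (lam n) k) ->
  (forall n, (N <= n)%N -> phi (lam n) = 0) ->
  Rintegral m [set: borel G] ((fun x =>
      normc (\sum_(n < N) ((phi (lam n))%:C * a n) * h n x) `^ p) : borel G -> R) <=
  C `^ p * Rintegral m [set: borel G] ((fun x => normc (f x) `^ p) : borel G -> R).
Proof.
move=> p12 C0 hphi fp ha hspec hN; apply/ler_addgt0Pr => e e0.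
have /andP[p1 p2] := p12.
have p0 : 0 < p by exact: lt_le_trans ltr01 p1.
(* This value of [d] solves [p * d ^ (p / 2) = e]. *)
have d0 : 0 < (e / p) `^ (2 / p) by rewrite powR_gt0 // divr_gt0.
have := multiplier_Lp_delta p12 C0 d0 hphi fp ha hspec hN.
rewrite -powRrM (_ : 2 / p * (p / 2) = 1); last by field; rewrite gt_eqF.
by rewrite powRr1 ?divr_ge0 ?(ltW e0) ?(ltW p0) // [p * _]mulrC divfK // gt_eqF.
Qed.

(** Let [T] be the squared L_2 norm and [S = sqrt (N T)], a bound for |Q| by Cauchy-Schwarz on the
    coefficients. As p <= 2, [|Q|^2 <= S^(2-p) |Q|^p], so [S^2 = N T <= S^(2-p) N J] with [J] the
    integral of |Q|^p. Dividing by [S^(2-p)] leaves [S^p <= N J]. *)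
Lemma nikolskii (b : nat -> R[i]) N (p : R) (x : G) : 1 <= p <= 2 ->
  normc (\sum_(n < N) b n * h n x) `^ p <=
  N%:R * Rintegral m [set: borel G] ((fun y =>
     normc (\sum_(n < N) b n * h n y) `^ p) : borel G -> R).
Proof.
move=> /andP[p1 p2]; set Q := fun y => \sum_(n < N) b n * h n y.
have p0 : 0 < p by exact: lt_le_trans ltr01 p1.
have hQ : trig_poly Q := dirichlet_poly_trig hh b N.
set J := Rintegral m _ _.
have J0 : 0 <= J by apply: Rintegral_ge0 => y _; exact: powR_ge0.
set T := \sum_(n < N) normc (b n) ^+ 2.
have T0 : 0 <= T by apply: sumr_ge0 => n _; exact: sqr_ge0.
have NT0 : 0 <= N%:R * T by rewrite mulr_ge0.
pose S := Num.sqrt (N%:R * T).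
have QS y : normc (Q y) <= S.
  rewrite -(@ler_pXn2r _ 2) ?nnegrE ?normc_ge0 ?sqrtr_ge0 // sqr_sqrtr //.
  apply: le_trans (cauchy_schwarz_card N (fun n => normc (b n))).
  rewrite ler_pXn2r ?nnegrE ?normc_ge0 ?sumr_ge0 // => [|n _]; last exact: normc_ge0.
  apply: le_trans (normc_sum _ _) _; apply: ler_sum => n _.
  by rewrite normcM (normc_character _ (hh n).1) mulr1.
have S0 : 0 <= S := sqrtr_ge0 _.
have [S_eq0|S_neq0] := eqVneq S 0.
  have -> : normc (Q x) = 0.
    by apply/eqP; rewrite eq_le normc_ge0 andbT -S_eq0.
  by rewrite powR0 ?gt_eqF // mulr_ge0.
have Sgt0 : 0 < S by rewrite lt_def S_neq0.
have TJ : T <= S `^ (2 - p) * J.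
  rewrite /T -(dirichlet_poly_parseval hlam hG hh).
  rewrite -RintegralZl //; last by apply: trig_integrable_normc_powR => //; exact: ltW.
  have i2 : m.-integrable [set: borel G] (EFin \o ((fun y => normc (Q y) ^+ 2)
      : borel G -> R)).
    have := trig_integrable_normc_powR (ler0n R 2) hQ.
    rewrite (_ : (fun y => _) = (fun y => normc (Q y) ^+ 2)) //; apply/funext => y.
    by rewrite powR_mulrn ?normc_ge0.
  apply: le_Rintegral => //.
    by apply: integrableZ_EFin; apply: trig_integrable_normc_powR => //; exact: ltW.
  move=> y _; rewrite -powR_mulrn ?normc_ge0 //.
  have [Q0|Q0] := eqVneq (normc (Q y)) 0.
    by rewrite Q0 powR0 ?pnatr_eq0 // mulr_ge0 ?powR_ge0.
  have -> : normc (Q y) `^ 2%:R = normc (Q y) `^ (2 - p) * normc (Q y) `^ p.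
    by rewrite -powRD ?subrK // Q0 implybT.
  apply: ler_wpM2r; first exact: powR_ge0.
  by apply: ge0_ler_powR; rewrite ?nnegrE ?subr_ge0 ?normc_ge0.
apply: (@le_trans _ _ (S `^ p)).
  by apply: ge0_ler_powR; rewrite ?nnegrE ?normc_ge0 ?QS ?(ltW p0).
have E : S `^ (2 - p) * S `^ p = N%:R * T.
  rewrite -powRD; last by rewrite S_neq0 implybT.
  by rewrite subrK powR_mulrn // sqr_sqrtr.
have S2 : 0 < S `^ (2 - p) by rewrite powR_gt0.
rewrite -(ler_pM2l S2) E mulrCA; apply: ler_wpM2l => //.
Qed.

(** Write [|Q|^q = |Q|^(q-p) |Q|^p] and estimate the first factor by the sup bound. *)
Lemma nikolskii_pq (b : nat -> R[i]) N (p q : R) : 1 <= p <= 2 -> p <= q ->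
  Rintegral m [set: borel G] ((fun y =>
     normc (\sum_(n < N) b n * h n y) `^ q) : borel G -> R) <=
  (N%:R * Rintegral m [set: borel G] ((fun y =>
     normc (\sum_(n < N) b n * h n y) `^ p) : borel G -> R)) `^ ((q - p) / p) *
  Rintegral m [set: borel G] ((fun y =>
     normc (\sum_(n < N) b n * h n y) `^ p) : borel G -> R).
Proof.
move=> p12 pq; have /andP[p1 p2] := p12.
have p0 : 0 < p by exact: lt_le_trans ltr01 p1.
have q0 : 0 < q by exact: lt_le_trans pq.
have hQ := dirichlet_poly_trig hh b N.
set Q := fun y => \sum_(n < N) b n * h n y in hQ *.
have pi := trig_integrable_normc_powR (ltW p0) hQ.
set J := Rintegral m _ ((fun y => normc (Q y) `^ p) : borel G -> R).
have J0 : 0 <= J by apply: Rintegral_ge0 => y _; exact: powR_ge0.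
have <- := RintegralZl ((N%:R * J) `^ ((q - p) / p)) measurableT pi.
apply: le_Rintegral => //.
- by apply: trig_integrable_normc_powR => //; exact: ltW.
- exact: integrableZ_EFin.
move=> y _; have hy := nikolskii b N y p12.
rewrite -/(Q y) -/J in hy; move: hy; set z := normc (Q y) => hy.
have z0 : 0 <= z by exact: normc_ge0.
have [->|zn0] := eqVneq z 0.
  by rewrite powR0 ?gt_eqF // mulr_ge0 ?powR_ge0.
have -> : z `^ q = z `^ (q - p) * z `^ p.
  by rewrite -powRD ?subrK // zn0 implybT.
rewrite ler_wpM2r ?powR_ge0 //.
have -> : z `^ (q - p) = (z `^ p) `^ ((q - p) / p).
  by rewrite -powRrM; congr powR; field; rewrite gt_eqF.
apply: ge0_ler_powR => //; rewrite ?nnegrE ?powR_ge0 //; last exact: mulr_ge0.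
by apply: divr_ge0; [rewrite subr_ge0 | exact: ltW].
Qed.

End lp_bounds.

(** * Series of functions *)

Lemma bounded_series_cvg (R : realType) (v : nat -> R) (B : R) :
  (forall n, \sum_(k < n) `|v k| <= B) -> cvgn (series v) /\ `|limn (series v)| <= B.
Proof.
move=> vB.
have cv : cvgn (series v).
  apply: normed_cvg; apply: nondecreasing_is_cvgn.
    exact: (@nondecreasing_series R (fun k => `|v k|) xpredT 0 (fun _ _ _ => normr_ge0 _)).
  exists B => _ [n _ <-]; have := vB n.
  by rewrite -(big_mkord xpredT (fun k => `|v k|)).
split=> //.
have vn n : `|series v n| <= B.
  rewrite [series v n]big_mkord; exact: le_trans (ler_norm_sum _ _ _) (vB n).
rewrite ler_norml; apply/andP; split.
  apply: limr_ge => //; apply: nearW => n.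
  by have := vn n; rewrite ler_norml => /andP[].
apply: limr_le => //; apply: nearW => n.
by have := vn n; rewrite ler_norml => /andP[].
Qed.

Lemma Re_series (R : realType) (Q : nat -> R[i]) n :
  complex.Re (\sum_(k < n) Q k) = series (fun k => complex.Re (Q k)) n.
Proof.
by rewrite [RHS]big_mkord; elim/big_ind2: _ => // x1 x2 y1 y2 <- <-; rewrite ReD.
Qed.

Lemma Im_series (R : realType) (Q : nat -> R[i]) n :
  complex.Im (\sum_(k < n) Q k) = series (fun k => complex.Im (Q k)) n.
Proof.
by rewrite [RHS]big_mkord; elim/big_ind2: _ => // x1 x2 y1 y2 <- <-; rewrite ImD.
Qed.

(** The last clause is shaped for Fourier coefficients: [u] will be a conjugate character, against
    which the partial sums integrate to an eventually constant value. The factor 2 comes from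
    bounding real and imaginary parts separately. *)
Lemma dominated_series (d : measure_display) (T : measurableType d) (R : realType)
    (m : probability T R) (Q : nat -> T -> R[i]) (c : nat -> R) (U : T -> R) (B : R) :
  (forall k, cmeasurable (Q k)) -> m.-integrable [set: T] (EFin \o U) ->
  (forall k x, normc (Q k x) <= c k * U x) -> (forall x, 0 <= U x) ->
  (forall n, \sum_(k < n) c k <= B) ->
  exists g : T -> R[i], [/\ cmeasurable g, forall x, normc (g x) <= 2 * (B * U x) &
    forall (u : T -> R[i]) (z : R[i]), cmeasurable u -> (forall x, normc (u x) <= 1) ->
      (exists N, forall n, (N <= n)%N ->
         cintegral m (fun x => (\sum_(k < n) Q k x) * u x) = z) ->
      cintegral m (fun x => g x * u x) = z].
Proof.
move=> mQ iU QU U0 cB.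
have sQ x n : \sum_(k < n) normc (Q k x) <= B * U x.
  apply: le_trans (ler_sum _ (fun (k : 'I_n) _ => QU k x)) _.
  by rewrite -mulr_suml; exact: ler_wpM2r (U0 x) _ _ (cB n).
pose S n x := \sum_(k < n) Q k x.
have SB n x : normc (S n x) <= B * U x by exact: le_trans (normc_sum _ _) (sQ x n).
have [cRe hRe] : (forall x, cvgn (series (fun k => complex.Re (Q k x)))) /\
    (forall x, `|limn (series (fun k => complex.Re (Q k x)))| <= B * U x).
  suff H x : cvgn (series (fun k => complex.Re (Q k x))) /\
    `|limn (series (fun k => complex.Re (Q k x)))| <= B * U x.
    by split=> x; have [] := H x.
  apply: bounded_series_cvg => n; apply: le_trans (sQ x n).
  by apply: ler_sum => k _; exact: ler_norm_Re.
have [cIm hIm] : (forall x, cvgn (series (fun k => complex.Im (Q k x)))) /\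
    (forall x, `|limn (series (fun k => complex.Im (Q k x)))| <= B * U x).
  suff H x : cvgn (series (fun k => complex.Im (Q k x))) /\
    `|limn (series (fun k => complex.Im (Q k x)))| <= B * U x.
    by split=> x; have [] := H x.
  apply: bounded_series_cvg => n; apply: le_trans (sQ x n).
  by apply: ler_sum => k _; exact: ler_norm_Im.
pose g x : R[i] := limn (series (fun k => complex.Re (Q k x))) +i*
                   limn (series (fun k => complex.Im (Q k x))).
have gRe x : complex.Re (S n x) @[n --> \oo] --> complex.Re (g x).
  rewrite (_ : (fun n => _) = series (fun k => complex.Re (Q k x))); first exact: cRe.
  by apply/funext => n; rewrite -Re_series.
have gIm x : complex.Im (S n x) @[n --> \oo] --> complex.Im (g x).
  rewrite (_ : (fun n => _) = series (fun k => complex.Im (Q k x))); first exact: cIm.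
  by apply/funext => n; rewrite -Im_series.
have mS n : cmeasurable (S n) by apply: cmeasurable_sum.
have mg : cmeasurable g.
  split.
    apply: (@measurable_fun_cvg _ T R setT (fun n x => complex.Re (S n x))) => //.
    by move=> n; case: (mS n).
  apply: (@measurable_fun_cvg _ T R setT (fun n x => complex.Im (S n x))) => //.
  by move=> n; case: (mS n).
exists g; split=> // [x|u z mu u1 [N hN]].
  apply: le_trans (normc_le_ReIm _) _; rewrite mulr_natl mulr2n lerD //.
    exact: hRe.
  exact: hIm.
have mSu n : cmeasurable (fun x => S n x * u x) by exact: cmeasurableM.
have SuB n x : normc (S n x * u x) <= B * U x.
  rewrite normcM -[leRHS]mulr1 ler_pM ?normc_ge0 //.
have iBU : m.-integrable [set: T] (EFin \o (fun x => B * U x)).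
  exact: integrableZ_EFin.
have eventually_lim (F : nat -> T -> R) (H : T -> R) (y : R) :
    (forall n, measurable_fun [set: T] (F n)) ->
    (forall x, F n x @[n --> \oo] --> H x) ->
    (forall n x, `|F n x| <= B * U x) ->
    (forall n, (N <= n)%N -> Rintegral m [set: T] (F n) = y) ->
    Rintegral m [set: T] H = y.
  move=> mF FH FU hy.
  have iF n : m.-integrable [set: T] (EFin \o F n).
    exact: integrable_le (mF n) (FU n) iBU.
  have := @dominated_cvg _ T R m setT measurableT (fun n => EFin \o F n) (EFin \o H)
    (EFin \o (fun x => B * U x)) _ _ _ iBU _.
  move=> hd.
  have {}hd : (\int[m]_x (EFin \o F n) x)%E @[n --> \oo] --> (\int[m]_x (EFin \o H) x)%E.
    apply: hd => //.
    - by move=> n; apply/measurable_EFinP.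
    - by move=> x _; apply: cvg_EFin; [exact: nearW | exact: FH].
    - by move=> n x _ /=; rewrite lee_fin.
  have hc : (\int[m]_x (EFin \o F n) x)%E @[n --> \oo] --> y%:E.
    apply: cvg_near_cst; exists N => // n /= Nn.
    rewrite -(hy n Nn) /Rintegral fineK //.
    exact: integrable_fin_num (iF n).
  by rewrite /Rintegral (cvg_unique _ hd hc).
apply: complex_ext.
  apply: (eventually_lim (fun n x => complex.Re (S n x * u x))).
  - by move=> n; case: (mSu n).
  - move=> x; under eq_fun do rewrite ReM; rewrite ReM.
    by apply: cvgB; apply: cvgMl => //.
  - by move=> n x; exact: le_trans (ler_norm_Re _) (SuB n x).
  - by move=> n /hN <-.
apply: (eventually_lim (fun n x => complex.Im (S n x * u x))).
- by move=> n; case: (mSu n).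
- move=> x; under eq_fun do rewrite ImM; rewrite ImM.
  by apply: cvgD; apply: cvgMl => //.
- by move=> n x; exact: le_trans (ler_norm_Im _) (SuB n x).
- by move=> n /hN <-.
Qed.

Lemma ae_cintegral (d : measure_display) (T : measurableType d) (R : realType)
    (m : {measure set T -> \bar R}) (f g : T -> R[i]) :
  cmeasurable f -> cmeasurable g -> (\forall x \ae m, f x = g x) ->
  cintegral m f = cintegral m g.
Proof.
move=> [f1 f2] [g1 g2] fg; apply: complex_ext; rewrite /cintegral /Rintegral /=; congr fine.
  apply: ae_eq_integral => //; try exact/measurable_EFinP.
  by apply: filterS fg => x fgx _ /=; rewrite fgx.
apply: ae_eq_integral => //; try exact/measurable_EFinP.
by apply: filterS fg => x fgx _ /=; rewrite fgx.
Qed.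

Lemma geometric_sum_le (R : realType) (a x : R) n : 0 <= a -> 0 < x < 1 ->
  \sum_(k < n) a * x ^+ k <= a / (1 - x).
Proof.
move=> a0 /andP[x0 x1].
have := @geometric_le_lim R n a x a0 x0; rewrite ger0_norm ?(ltW x0) // => /(_ x1).
by rewrite /series /= big_mkord.
Qed.

(* [U ^ r] is the sum of the [(|Q k| / t ^ k) ^ r] with [t ^ 2 = rho], and [A] is
   the set where this sum is finite. *)
Lemma Lp_dominator (d : measure_display) (T : measurableType d) (R : realType)
    (m : probability T R) (Q : nat -> T -> R[i]) (r K rho : R) :
  1 <= r -> 0 <= K -> 0 < rho < 1 -> (forall k, cmeasurable (Q k)) ->
  (forall k, m.-integrable [set: T] (EFin \o (fun x => normc (Q k x) `^ r))) ->
  (forall k, Rintegral m [set: T] (fun x => normc (Q k x) `^ r) <=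
     (K * rho ^+ k) `^ r) ->
  exists (A : set T) (U : T -> R), [/\ measurable A, \forall x \ae m, A x,
    forall x, 0 <= U x, m.-integrable [set: T] (EFin \o (fun x => U x `^ r)) &
    forall k x, A x -> normc (Q k x) <= Num.sqrt rho ^+ k * U x].
Proof.
move=> r1 K0 /andP[rho0 rho1] mQ iQ hQ.
have r0 : 0 < r by exact: lt_le_trans r1.
(* The decay [rho ^ k = t ^ k * t ^ k] is shared out: one factor makes the integrals of
   [(|Q k| / t ^ k) ^ r] summable, the other survives as pointwise decay. Neither Minkowski's
   inequality nor completeness of L_r enters. *)
pose t := Num.sqrt rho.
have t0 : 0 < t by rewrite sqrtr_gt0.
have tk0 k : 0 < t ^+ k by rewrite exprn_gt0.
have tt : t ^+ 2 = rho by rewrite sqr_sqrtr // ltW.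
have t1 : t < 1 by rewrite -(@ltr_pXn2r _ 2) ?nnegrE ?(ltW t0) // tt expr1n.
pose tr := t `^ r.
have tr0 : 0 < tr by rewrite powR_gt0.
have tr1 : tr < 1.
  have <- : 1 `^ r = 1 :> R by rewrite powR1.
  by apply: gt0_ltr_powR; rewrite ?nnegrE ?(ltW t0).
pose F k x := (normc (Q k x) / t ^+ k) `^ r.
have FE k x : F k x = (t ^+ k)^-1 `^ r * normc (Q k x) `^ r.
  by rewrite /F powRM ?normc_ge0 ?invr_ge0 ?(ltW (tk0 k)) // mulrC.
have F0 k x : 0 <= F k x by exact: powR_ge0.
have iF k : m.-integrable [set: T] (EFin \o F k).
  rewrite (_ : F k = fun x => (t ^+ k)^-1 `^ r * normc (Q k x) `^ r).
    exact: integrableZ_EFin.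
  by apply/funext => x; exact: FE.
have hF k : Rintegral m [set: T] (F k) <= K `^ r * tr ^+ k.
  rewrite (_ : F k = fun x => (t ^+ k)^-1 `^ r * normc (Q k x) `^ r); last first.
    by apply/funext => x; exact: FE.
  rewrite RintegralZl //.
  apply: le_trans (ler_wpM2l (powR_ge0 _ _) (hQ k)) _.
  rewrite -powRM ?invr_ge0 ?(ltW (tk0 k)) //; last first.
    by apply: mulr_ge0 => //; rewrite exprn_ge0 // ltW.
  have -> : (t ^+ k)^-1 * (K * rho ^+ k) = K * t ^+ k.
    by rewrite -tt -exprM mulnC exprM expr2; field; rewrite gt_eqF.
  rewrite powRM ?(ltW (tk0 k)) // /tr -!powR_mulrn ?(ltW t0) ?powR_ge0 //.
  by rewrite powRAC.
have mF k : measurable_fun [set: T] (EFin \o F k) by case/integrableP : (iF k).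
pose V x := (\sum_(0 <= k <oo) (EFin \o F k) x)%E.
have V0 x : (0 <= V x)%E by apply: nneseries_ge0 => k _ _; rewrite /= lee_fin.
have mV : measurable_fun [set: T] V.
  by apply: ge0_emeasurable_sum => // k x _ _; rewrite /= lee_fin.
have iV : m.-integrable [set: T] V.
  apply/integrableP; split=> //.
  under eq_integral do rewrite gee0_abs //.
  rewrite integral_nneseries //; last by move=> k x _; rewrite /= lee_fin.
  apply: (@le_lt_trans _ _ (K `^ r / (1 - tr))%:E); last exact: ltry.
  have iF0 k : (0 <= \int[m]_x (EFin \o F k) x)%E.
    by apply: integral_ge0 => x _; rewrite /= lee_fin.
  apply: lime_le; first by apply: is_cvg_nneseries => k _ _; exact: iF0.
  apply: nearW => n; rewrite big_mkord.
  have := @geometric_sum_le R (K `^ r) tr n (powR_ge0 _ _).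
  rewrite tr0 tr1 -lee_fin => /(_ isT); apply: le_trans.
  rewrite -sumEFin; apply: lee_sum => k _.
  rewrite -[leLHS]fineK; last exact: integrable_fin_num (iF k).
  by rewrite lee_fin; exact: hF.
pose A := [set x | V x \is a fin_num].
have mA : measurable A.
  by have := emeasurable_fin_num measurableT mV; rewrite setTI.
pose U x := fine (V x) `^ r^-1.
have fV0 x : 0 <= fine (V x) by exact: fine_ge0.
have UE x : U x `^ r = fine (V x).
  by rewrite /U -powRrM mulVf ?gt_eqF // powRr1.
exists A, U; split=> //.
- have := integrable_ae measurableT iV; apply: filterS => x; exact.
- by move=> x; exact: powR_ge0.
- rewrite (_ : (fun x => _) = fun x => fine (V x)); last exact/funext.
  apply: le_integrable iV => //.
    by apply/measurable_EFinP; exact: (measurableT_comp (fine_measurable _)).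
  move=> x _ /=; rewrite ger0_norm // gee0_abs //.
  by case: (V x) (V0 x) => //= ? ; rewrite ?lee_fin // leey.
move=> k x Ax.
have FV : F k x <= fine (V x).
  rewrite -lee_fin fineK //.
  apply: le_trans (nneseries_lim_ge k.+1 _); last by move=> *; rewrite /= lee_fin.
  rewrite big_nat_recr //= leeDr //.
  by apply: sume_ge0 => i _; rewrite lee_fin.
have hx : normc (Q k x) / t ^+ k <= U x.
  have qt0 : 0 <= normc (Q k x) / t ^+ k.
    by rewrite divr_ge0 ?normc_ge0 // ltW.
  rewrite -[leLHS]powRr1 // -(mulfV (lt0r_neq0 r0)) powRrM.
  apply: ge0_ler_powR; rewrite ?nnegrE ?powR_ge0 //.
  by rewrite invr_ge0 ltW.
by rewrite mulrC -ler_pdivrMr.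
Qed.

Lemma Lp_series (d : measure_display) (T : measurableType d) (R : realType)
    (m : probability T R) (Q : nat -> T -> R[i]) (r K rho : R) :
  1 <= r -> 0 <= K -> 0 < rho < 1 -> (forall k, cmeasurable (Q k)) ->
  (forall k, m.-integrable [set: T] (EFin \o (fun x => normc (Q k x) `^ r))) ->
  (forall k, Rintegral m [set: T] (fun x => normc (Q k x) `^ r) <=
     (K * rho ^+ k) `^ r) ->
  exists g : T -> R[i], in_Lp m r%:E g /\
    forall (u : T -> R[i]) (z : R[i]), cmeasurable u -> (forall x, normc (u x) <= 1) ->
      (exists N, forall n, (N <= n)%N ->
         cintegral m (fun x => (\sum_(k < n) Q k x) * u x) = z) ->
      cintegral m (fun x => g x * u x) = z.
Proof.
move=> r1 K0 rho01 mQ iQ hQ.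
have r0 : 0 < r by exact: lt_le_trans r1.
have [A [U [mA aA U0 iU QU]]] := Lp_dominator r1 K0 rho01 mQ iQ hQ.
have /andP[rho0 rho1] := rho01.
pose t := Num.sqrt rho.
have t0 : 0 < t by rewrite sqrtr_gt0.
have t1 : t < 1.
  rewrite -(@ltr_pXn2r _ 2) ?nnegrE ?(ltW t0) // sqr_sqrtr ?(ltW rho0) //.
  by rewrite expr1n.
(* Cutting off the null complement of [A] makes the domination hold at every point, without changing
   any integral. *)
pose P k x := Q k x * (\1_A x : R)%:C.
have mP k : cmeasurable (P k).
  apply: cmeasurableM => //; split; last exact: measurable_cst.
  exact: measurable_indic.
have mU : measurable_fun [set: T] U.
  have -> : U = fun x => (U x `^ r) `^ r^-1.
    by apply/funext => x; rewrite -powRrM mulfV ?gt_eqF // powRr1.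
  apply: (measurableT_comp (measurable_powR _)).
  by case/integrableP : iU => /measurable_EFinP.
have iU1 : m.-integrable [set: T] (EFin \o U).
  apply: (integrable_le (g := fun x => 1 + U x `^ r)) => //.
    by move=> x; rewrite ger0_norm //; exact: ler_1D_powR.
  by apply: integrableD_EFin => //; exact: integrable_cst.
have PU k x : normc (P k x) <= t ^+ k * U x.
  rewrite /P normcM normc_real indicE; have [Ax|Ax] := pselect (A x).
    rewrite mem_set //= normr1 mulr1; exact: QU.
  rewrite memNset //= normr0 mulr0; apply: mulr_ge0 => //.
  by apply: exprn_ge0; exact: ltW.
have tB n : \sum_(k < n) t ^+ k <= (1 - t)^-1.
  have := @geometric_sum_le R 1 t n ler01; rewrite t0 t1 mul1r => /(_ isT).
  by under eq_bigr do rewrite mul1r.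
have [g [mg gU hg]] := dominated_series mP iU1 PU U0 tB.
exists g; split.
  apply/in_Lp_integrable => //; split => //.
  apply: (integrable_le (g := fun x => (2 * (1 - t)^-1) `^ r * U x `^ r)).
  - apply: (measurableT_comp (measurable_powR _)); exact: measurable_normc.
  - move=> x; rewrite ger0_norm ?powR_ge0 // -powRM //; last first.
      by rewrite mulr_ge0 // invr_ge0 subr_ge0 ltW.
    apply: ge0_ler_powR; rewrite ?nnegrE ?normc_ge0 ?(ltW r0) //.
      by rewrite !mulr_ge0 // invr_ge0 subr_ge0 ltW.
    by rewrite -mulrA.
  - exact: integrableZ_EFin.
move=> u z mu u1 [N hN]; apply: hg => //; exists N => n /hN <-.
apply: ae_cintegral.
- by apply: cmeasurableM => //; exact: cmeasurable_sum.
- by apply: cmeasurableM => //; exact: cmeasurable_sum.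
apply: filterS aA => x Ax; congr (_ * _); apply: eq_bigr => k _.
by rewrite /P indicE mem_set //= mulr1.
Qed.

Lemma Linfty_series (d : measure_display) (T : measurableType d) (R : realType)
    (m : probability T R) (Q : nat -> T -> R[i]) (K rho : R) :
  0 <= K -> 0 < rho < 1 -> (forall k, cmeasurable (Q k)) ->
  (forall k x, normc (Q k x) <= K * rho ^+ k) ->
  exists g : T -> R[i], in_Lp m +oo%E g /\
    forall (u : T -> R[i]) (z : R[i]), cmeasurable u -> (forall x, normc (u x) <= 1) ->
      (exists N, forall n, (N <= n)%N ->
         cintegral m (fun x => (\sum_(k < n) Q k x) * u x) = z) ->
      cintegral m (fun x => g x * u x) = z.
Proof.
move=> K0 rho01 mQ hQ.
have hQ1 k x : normc (Q k x) <= K * rho ^+ k * (fun=> 1) x by rewrite mulr1.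
have [g [mg gU hg]] := dominated_series mQ (integrable_cst m 1) hQ1
  (fun=> ler01) (fun n => geometric_sum_le n K0 rho01).
exists g; split=> //.
exact: in_Linfty mg gU.
Qed.

(** Monotonicity makes the indices with [lam n < y] an initial segment, so the counting function can
    be described by this equivalence instead of a cardinality. *)
Lemma frequency_count (R : realType) (lam : nat -> R) (y : R) : is_frequency lam ->
  exists N : nat, forall n, (n < N)%N = (lam n < y).
Proof.
move=> [_ mono /cvgryPge /(_ y) [M _ hM]].
have ex : exists n, y <= lam n by exists M; apply: hM => /=.
case: (ex_minnP ex) => N yN minN; exists N => n.
have [nN|Nn] := ltnP n N.
  by apply/esym; rewrite ltNge; apply/negP => /minN; rewrite leqNgt nN.
apply/esym/negbTE; rewrite -leNgt; apply: le_trans yN _.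
by move: Nn; rewrite leq_eqVlt => /predU1P[->//|/mono /ltW].
Qed.

Lemma abscissa_ge0 (R : realType) (lam : nat -> R) : is_frequency lam ->
  (0 <= abscissa lam)%E.
Proof.
move=> [lam0 _ _]; apply: le_ereal_inf_tmp => _ [V [M _ hM] <-].
apply: le_trans (_ : (ln M.+1%:R / lam M)%:E <= _)%E; last first.
  by apply: ereal_sup_ubound; exists M => //; apply: hM => /=.
by rewrite lee_fin divr_ge0 // ln_ge0 // ler1n.
Qed.

(** From some index M on, [ln (n + 1) < L * lam n]. At [n = N - 1], the last index with [lam n < y],
    this reads [N <= e^(L y)]; the constant [c] takes care of small [N]. *)
Lemma abscissa_growth (R : realType) (lam : nat -> R) (L : R) : is_frequency lam ->
  (abscissa lam < L%:E)%E ->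
  exists2 c : R, 0 < c & forall (y : R) (N : nat), 0 <= y ->
    (forall n, (n < N)%N = (lam n < y)) -> N%:R <= c * expR (L * y).
Proof.
move=> hlam hL; have [lam0 mono _] := hlam.
have L0 : 0 < L by rewrite -lte_fin; exact: le_lt_trans (abscissa_ge0 hlam) hL.
have [_ [V [M _ hM] <-] hV] := ereal_inf_lt hL.
have hn n : (M <= n)%N -> ln n.+1%:R / lam n < L.
  move=> Mn; rewrite -lte_fin; apply: le_lt_trans hV.
  by apply: ereal_sup_ubound; exists n => //; exact: hM.
(* Beyond [M + 2] the last index is at least 1, so its frequency is positive even if [lam 0 = 0],
   and the quotient by [lam n] can be cleared. *)
exists M.+2%:R => // y N y0 hN.
have e1 : 1 <= expR (L * y) by rewrite -expR0 ler_expR mulr_ge0 // ltW.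
have [NM|MN] := leqP N M.+2.
  by apply: (@le_trans _ _ M.+2%:R); rewrite ?ler_nat // ler_peMr.
case: N hN MN => // n hN MN.
have ny : lam n < y by rewrite -hN.
have ln0 : 0 < lam n by apply: le_lt_trans (lam0 0%N) (mono _ _ _); lia.
have := hn n; rewrite ltr_pdivrMr // => /(_ ltac:(lia)) h.
have h2 : n.+1%:R <= expR (L * y).
  rewrite -[leLHS]lnK ?posrE // ler_expR; apply: le_trans (ltW h) _.
  by rewrite ler_pM2l // ltW.
apply: le_trans h2 _; rewrite ler_peMl ?expR_ge0 // ler1n //.
Qed.

Lemma frequency_count_decay (R : realType) (lam : nat -> R) (theta sigma : R) :
  is_frequency lam -> 0 <= theta -> (abscissa lam * theta%:E < sigma%:E)%E ->
  0 < sigma /\ exists K rho : R, [/\ 0 <= K, 0 < rho < 1 &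
    forall k N : nat, (forall n, (n < N)%N = (lam n < k%:R + 1)) ->
      N%:R `^ theta * expR (- (k%:R * sigma)) <= K * rho ^+ k].
Proof.
move=> hlam th0 hs.
have ab0 := abscissa_ge0 hlam.
have s0 : 0 < sigma.
  by rewrite -lte_fin; apply: le_lt_trans hs; apply: mule_ge0 => //; rewrite lee_fin.
split=> //.
(* Here the abscissa may be infinite, since [+oo * 0 = 0], and only [sigma > 0] remains. For
   [theta > 0] the hypothesis forces a finite abscissa and leaves room for an [L] between it and
   [sigma / theta]. *)
have [th_eq0|th_neq0] := eqVneq theta 0.
  exists 1, (expR (- sigma)); split => //.
    by rewrite expR_gt0 /= -[ltRHS]expR0 ltr_expR oppr_lt0.
  by move=> k N _; rewrite th_eq0 powRr0 !mul1r -expRM_natl mulrN mulr_natl.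
have th : 0 < theta by rewrite lt_def th_neq0.
have [L hL hLs] : exists2 L : R, (abscissa lam < L%:E)%E & L * theta < sigma.
  have : (abscissa lam < (sigma / theta)%:E)%E.
    by rewrite EFinM lte_pdivlMr.
  move: ab0; case: (abscissa lam) => [l|//|//] _; rewrite lte_fin => hl.
  exists ((l + sigma / theta) / 2); first by rewrite lte_fin midf_lt.
  by rewrite -ltr_pdivlMr // midf_lt.
have [c c0 hc] := abscissa_growth hlam hL.
exists (c `^ theta * expR (L * theta)), (expR (L * theta - sigma)); split.
- by rewrite mulr_ge0 ?powR_ge0 // expR_ge0.
- by rewrite expR_gt0 /= -[ltRHS]expR0 ltr_expR subr_lt0.
move=> k N hN.
have k10 : 0 <= k%:R + 1 :> R by rewrite addr_ge0.
have hNc := hc _ _ k10 hN.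
have h1 : N%:R `^ theta <= c `^ theta * expR (L * (k%:R + 1) * theta).
  have -> : expR (L * (k%:R + 1) * theta) = expR (L * (k%:R + 1)) `^ theta.
    by rewrite [RHS]/powR gt_eqF ?expR_gt0 // expRK mulrC.
  rewrite -powRM ?(ltW c0) ?expR_ge0 //.
  apply: ge0_ler_powR; rewrite ?nnegrE //.
  by rewrite mulr_ge0 ?expR_ge0 // ltW.
apply: le_trans (ler_wpM2r (expR_ge0 _) h1) _.
rewrite -!mulrA -!expRD ler_wpM2l ?powR_ge0 // -expRM_natl -expRD ler_expR.
by rewrite le_eqVlt; apply/orP; left; apply/eqP; rewrite -mulr_natl; ring.
Qed.

(** * The translation operator *)

Lemma nikolskii_exponent (R : realType) (p q x c J : R) : 0 < p -> p <= q ->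
  0 <= x -> 0 <= c -> 0 <= J -> J <= c `^ p ->
  (x * J) `^ ((q - p) / p) * J <= (x `^ (p^-1 - q^-1) * c) `^ q.
Proof.
move=> p0 pq x0 c0 J0 Jc; have q0 : 0 < q by exact: lt_le_trans pq.
have e0 : 0 <= (q - p) / p by rewrite divr_ge0 ?subr_ge0 // ltW.
have cp0 : 0 <= c `^ p := powR_ge0 _ _.
apply: (@le_trans _ _ ((x * c `^ p) `^ ((q - p) / p) * c `^ p)).
  apply: ler_pM => //; first exact: powR_ge0.
  by apply: ge0_ler_powR => //; rewrite ?nnegrE; [exact: mulr_ge0..| exact: ler_wpM2l].
rewrite powRM // -mulrA [leRHS]powRM ?powR_ge0 // -!powRrM.
have -> : (p^-1 - q^-1) * q = (q - p) / p by field; rewrite !gt_eqF.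
have -> : p * ((q - p) / p) = q - p by field; rewrite gt_eqF.
by rewrite -powRD ?subrK // (gt_eqF q0).
Qed.

(** The exponent 1/p - 1/q as a real number. The default branch of the match stands for [q = +oo],
    as [-oo] is excluded by [p <= q]. *)
Lemma inve_sub (R : realType) (p : R) (q : \bar R) : 0 < p -> (p%:E <= q)%E ->
  exists theta : R, [/\ 0 <= theta, (p%:E^-1 - q^-1)%E = theta%:E &
    theta = match q with r%:E => p^-1 - r^-1 | _ => p^-1 end].
Proof.
move=> p0; case: q => [r|_|//].
  rewrite lee_fin => pr; have r0 : 0 < r by exact: lt_le_trans pr.
  exists (p^-1 - r^-1); split=> //.
    by rewrite subr_ge0 lef_pV2 ?posrE.
  by rewrite !inver !gt_eqF.
exists p^-1; split=> //; first by rewrite invr_ge0 ltW.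
by rewrite inver gt_eqF // invey sube0.
Qed.

Theorem proposition1p3 (R : realType) (p : R) (q : \bar R)
    (lam : nat -> R) (sigma : R)
    (G : topologicalZmodType) (m : probability (borel G) R) (beta : R -> G)
    (hp1 : 1 <= p) (hp2 : p <= 2) (hpq : (p%:E <= q)%E)
    (hlam : is_frequency lam)
    (hG : is_dirichlet_group lam m beta)
    (hsigma : (abscissa lam * (p%:E^-1 - q^-1) < sigma%:E)%E) :
  forall D : dirichlet_series R,
    Hp lam m beta p%:E D -> Hp lam m beta q (translate lam sigma D).
Proof.
move=> D [f [fp hD hspec]].
have p12 : 1 <= p <= 2 by rewrite hp1.
have p0 : 0 < p by exact: lt_le_trans hp1.
have [theta [th0 thE thq]] := inve_sub p0 hpq.
rewrite thE in hsigma.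
have [s0 [K [rho [K0 rho01 hK]]]] := frequency_count_decay hlam th0 hsigma.
have [h hh] := choice (dg_char hG).
have hDn n : D n = fourier m f (h n) := hD n (h n) (hh n).
have [N hN] := choice (fun k : nat => frequency_count (k%:R + 1) hlam).
pose Q k x := \sum_(n < N k) ((block sigma k (lam n))%:C * D n) * h n x.
have hQ k : trig_poly (Q k) :=
  dirichlet_poly_trig hh (fun n => (block sigma k (lam n))%:C * D n) (N k).
have block0 k n : (N k <= n)%N -> block sigma k (lam n) = 0.
  by move=> Nn; apply: block_eq0; rewrite leNgt -hN -leqNgt.
have rho0 k : 0 <= rho ^+ k.
  by case/andP: rho01 => r0 _; rewrite exprn_ge0 // ltW.
pose I := Rintegral m [set: borel G] ((fun x => normc (f x) `^ p) : borel G -> R).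
have I0 : 0 <= I by apply: Rintegral_ge0 => x _; exact: powR_ge0.
pose C (k : nat) := expR (- (k%:R * sigma)) * expR (sigma * 2).
have C0 k : 0 < C k by rewrite mulr_gt0 // expR_gt0.
pose c k := C k * I `^ p^-1.
have c0 k : 0 <= c k by rewrite mulr_ge0 ?powR_ge0 // ltW.
pose K' := K * (expR (sigma * 2) * I `^ p^-1).
have K'0 : 0 <= K' by rewrite !mulr_ge0 ?powR_ge0 ?expR_ge0.
have NcK k : (N k)%:R `^ theta * c k <= K' * rho ^+ k.
  have -> : (N k)%:R `^ theta * c k = (N k)%:R `^ theta * expR (- (k%:R * sigma)) *
      (expR (sigma * 2) * I `^ p^-1) by rewrite /c /C; ring.
  have -> : K' * rho ^+ k = K * rho ^+ k * (expR (sigma * 2) * I `^ p^-1).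
    by rewrite /K'; ring.
  apply: ler_wpM2r; first by rewrite mulr_ge0 ?powR_ge0 ?expR_ge0.
  exact: hK (hN k).
pose J k := Rintegral m [set: borel G] ((fun x => normc (Q k x) `^ p) : borel G -> R).
have J0 k : 0 <= J k by apply: Rintegral_ge0 => x _; exact: powR_ge0.
(* In terms of norms, |Q_k|_p <= C_k |f|_p. *)
have Jc k : J k <= c k `^ p.
  rewrite /c powRM ?powR_ge0 ?(ltW (C0 k)) // -powRrM mulVf ?gt_eqF // powRr1 //.
  have hm := multiplier_Lp hlam hG hh p12 (C0 k) (multiplier_block k (ltW s0)) fp hDn
    hspec (block0 k).
  exact: hm.
have mQ k : cmeasurable (Q k : borel G -> R[i]) := trig_cmeasurable (hQ k).
have [g [gq hg]] : exists g : borel G -> R[i], in_Lp m q g /\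
    forall (u : borel G -> R[i]) (z : R[i]), cmeasurable u ->
      (forall x, normc (u x) <= 1) ->
      (exists M, forall n, (M <= n)%N ->
         cintegral m ((fun x => (\sum_(k < n) Q k x) * u x) : borel G -> R[i]) = z) ->
      cintegral m ((fun x => g x * u x) : borel G -> R[i]) = z.
  case: q hpq thq {hsigma thE} => [r hpq thq|hpq thq|//].
    have pr : p <= r by rewrite -lee_fin.
    have r1 : 1 <= r by exact: le_trans pr.
    have r0 : 0 <= r by exact: le_trans r1.
    apply: (@Lp_series _ (borel G) R m Q r K' rho) => // k.
      exact: trig_integrable_normc_powR.
    apply: le_trans (nikolskii_pq hlam hG hh
      (fun n => (block sigma k (lam n))%:C * D n) (N k) p12 pr) _.
    apply: le_trans (nikolskii_exponent p0 pr (ler0n _ _) (c0 k) (J0 k) (Jc k)) _.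
    apply: ge0_ler_powR; rewrite ?nnegrE //.
    - by rewrite mulr_ge0 ?powR_ge0.
    - by rewrite mulr_ge0.
    - by rewrite -thq.
  apply: (@Linfty_series _ (borel G) R m Q K' rho) => // k x.
  apply: le_trans (NcK k); rewrite thq /=.
  have z0 : 0 <= normc (Q k x) := normc_ge0 _.
  (* For [q = +oo] the sup bound is used directly, after taking p-th roots. *)
  have -> : normc (Q k x) = (normc (Q k x) `^ p) `^ p^-1.
    by rewrite -powRrM mulfV ?gt_eqF // powRr1.
  have -> : (N k)%:R `^ p^-1 * c k = ((N k)%:R * c k `^ p) `^ p^-1.
    by rewrite powRM ?powR_ge0 // -powRrM mulfV ?gt_eqF // powRr1.
  apply: ge0_ler_powR; rewrite ?nnegrE ?powR_ge0 ?invr_ge0 ?(ltW p0) //.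
    by rewrite mulr_ge0 ?powR_ge0.
  apply: le_trans (nikolskii hlam hG hh
    (fun n => (block sigma k (lam n))%:C * D n) (N k) x p12) _.
  by apply: ler_wpM2l => //; exact: Jc.
have sumQ (k : G -> R[i]) j : is_character k ->
    cintegral m ((fun x => (\sum_(i < j) Q i x) * (k x)^*) : borel G -> R[i]) =
    \sum_(i < j) fourier m (Q i) k.
  move=> hk; rewrite -(@cintegral_sum _ (borel G) R m _ _
    (fun (i : 'I_j) x => Q i x * (k x)^*)).
    by apply: eq_cintegral => x; rewrite mulr_suml.
  move=> i; apply: trig_cintegrable; apply: trigM => //.
  exact/trig_conj/trig_char.
have charu (k : G -> R[i]) : is_character k ->
    cmeasurable ((fun x => (k x)^*) : borel G -> R[i]) /\
    forall x, normc ((k x)^*) <= 1.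
  move=> hk; split; first exact/character_cmeasurable/character_conj.
  by move=> x; rewrite normc_conj normc_character.
exists g; split=> //.
  move=> n k hk; rewrite (frequency_char_unique hG hk (hh n)).
  have hc := (hh n).1; have [mu u1] := charu _ hc.
  apply/esym; apply: hg mu u1 _.
  (* From this index on the hats sum to 1 at [lam n], so the coefficient of the partial sum is
     already e^(-sigma lam_n) times [D n]. *)
  exists (Num.truncn (lam n + 1)).+1 => j Mj.
  rewrite sumQ // (eq_bigr (fun i : 'I_j => (block sigma i (lam n))%:C * D n)).
    have [lam0 _ _] := hlam.
    rewrite -mulr_suml -rmorph_sum sum_block //; first by rewrite mulrC.
    apply: le_trans (ltW (truncnS_gt _)) _; by rewrite ler_nat.
  move=> i _.
  rewrite (fourier_dirichlet_poly_coef hlam hG hh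
    (fun n => (block sigma i (lam n))%:C * D n)).
  by case: ltnP => // Nn; rewrite block0 // mul0r.
move=> k hk gk; apply: contrapT => nk; move/negP: gk; apply; apply/eqP.
have [mu u1] := charu _ hk.
(* Every block has its spectrum among the frequencies, so all partial sums have zero coefficient at
   [k]. *)
apply: hg mu u1 _; exists 0%N => j _.
rewrite sumQ // big1 // => i _.
rewrite (fourier_dirichlet_poly0 hG hh (fun n => (block sigma i (lam n))%:C * D n)) //.
by move=> n hn; apply: nk; exists n.
Qed.
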